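(* For every set $K\subset\mathbb{R}^n$ that is the support of an absolutely decaying measure there exists $\alpha=\alpha(K)>0$ such that for every $M\in\operatorname{GL}_n(\mathbb{R})\cap\operatorname{M}_{n\times n}(\mathbb{Z})$ and every $y\in\mathbb{T}^n$, the set $$\tilde E(M,y)=\{\mathbf{x}\in\mathbb{R}^n:\ y\notin\overline{\{\pi(M^k\mathbf{x}):k\in\mathbb{N}\}}\}$$ is $\alpha$-winning on $K$.
   Context: $\mathbb{T}^n=\mathbb{R}^n/\mathbb{Z}^n$ and $\pi:\mathbb{R}^n\to\mathbb{T}^n$ is the quotient map. For a closed set $K\subset\mathbb{R}^n$ and $0<\alpha,\beta<1$, Schmidt's $(\alpha,\beta)$-game on $K$ with target set $S$: balls are $B(\mathbf{x},\rho)=\{\mathbf{x}'\in K: d(\mathbf{x},\mathbf{x}')\le\rho\}$ with $\mathbf{x}\in K$, $\rho>0$ ($d$ Euclidean), and $(\mathbf{x}_2,\rho_2)\le_s(\mathbf{x}_1,\rho_1)$ means $\rho_2+d(\mathbf{x}_1,\mathbf{x}_2)\le\rho_1$. Bob picks $\omega_1=(\mathbf{x}_1,\rho_1)$; then Alice and Bob alternately pick $\omega_k'=(\mathbf{x}_k',\rho_k')\le_s\omega_k$ and $\omega_{k+1}\le_s\omega_k'$, centers in $K$, with $\rho_k'=\alpha\rho_k$, $\rho_{k+1}=\beta\rho_k'$. The nested balls intersect in one point $\mathbf{x}_\infty$; Alice wins if $\mathbf{x}_\infty\in S$. $S$ is $(\alpha,\beta)$-winning on $K$ if Alice has a strategy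 guaranteeing $\mathbf{x}_\infty\in S\cap K$, and $\alpha$-winning on $K$ if this holds for every $\beta\in(0,1)$. A locally finite Borel measure $\mu$ on $\mathbb{R}^n$ is $(C,\gamma)$-absolutely decaying ($C,\gamma>0$) if there is $\rho_0>0$ with $\mu(B(\mathbf{x},\rho)\cap\mathcal L^{(\varepsilon)})<C(\varepsilon/\rho)^\gamma\mu(B(\mathbf{x},\rho))$ for every affine hyperplane $\mathcal L$, $\mathbf{x}\in\operatorname{supp}\mu$, $0<\rho<\rho_0$, $\varepsilon>0$ (closed Euclidean balls; $\mathcal L^{(\varepsilon)}$ the closed $\varepsilon$-neighborhood of $\mathcal L$); $\mu$ is absolutely decaying if it is $(C,\gamma)$-absolutely decaying for some $C,\gamma>0$. *)

(* Defs.v *)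
From Stdlib Require Import Reals List.
From Stdlib Require Vectors.Fin.
Open Scope R_scope.

Definition Rn (n : nat) := Fin.t n -> R.

Fixpoint fsum (n : nat) : (Fin.t n -> R) -> R :=
  match n return (Fin.t n -> R) -> R with
  | O => fun _ => 0
  | S m => fun f => f (@Fin.F1 m) + fsum m (fun i => f (Fin.FS i))
  end.

Definition dot (n : nat) (a x : Rn n) : R := fsum n (fun i => a i * x i).

Definition dist (n : nat) (x y : Rn n) : R :=
  sqrt (fsum n (fun i => (x i - y i) ^ 2)).

Definition cball (n : nat) (x : Rn n) (r : R) : Rn n -> Prop :=
  fun z => dist n x z <= r.

Definition is_open (n : nat) (U : Rn n -> Prop) : Prop :=
  forall x, U x -> exists r, 0 < r /\ forall z, dist n x z < r -> U z.

Definition sigma_algebra (n : nat) (F : (Rn n -> Prop) -> Prop) : Prop :=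
  F (fun _ => True) /\
  (forall A, F A -> F (fun x => ~ A x)) /\
  (forall A : nat -> (Rn n -> Prop), (forall i, F (A i)) -> F (fun x => exists i, A i x)).

Definition borel (n : nat) (A : Rn n -> Prop) : Prop :=
  forall F, sigma_algebra n F -> (forall U, is_open n U -> F U) -> F A.

(* extended nonnegative reals: finite values and +infinity *)
Inductive ereal : Type := EFin (r : R) | EInf.

Definition ere_lt (a b : ereal) : Prop :=
  match a, b with
  | EFin a, EFin b => a < b
  | EFin _, EInf => True
  | EInf, _ => False
  end.

(* multiplication by a positive real constant *)
Definition ere_scale (c : R) (b : ereal) : ereal :=
  match b with EFin b => EFin (c * b) | EInf => EInf end.

Definition esum_is (f : nat -> ereal) (v : ereal) : Prop :=
  match v with
  | EFin l => exists g, (forall i, f i = EFin (g i)) /\ Un_cv (fun N => sum_f_R0 g N) l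
  | EInf => (exists i, f i = EInf) \/
            (exists g, (forall i, f i = EFin (g i)) /\ cv_infty (fun N => sum_f_R0 g N))
  end.

(* mu is a (positive) Borel measure on R^n; its values off the Borel sets are irrelevant *)
Definition is_measure (n : nat) (mu : (Rn n -> Prop) -> ereal) : Prop :=
  (forall A B, (forall x, A x <-> B x) -> mu A = mu B) /\
  (forall A, borel n A -> match mu A with EFin r => 0 <= r | EInf => True end) /\
  mu (fun _ => False) = EFin 0 /\
  (forall A : nat -> (Rn n -> Prop),
     (forall i, borel n (A i)) ->
     (forall i j x, i <> j -> A i x -> A j x -> False) ->
     esum_is (fun i => mu (A i)) (mu (fun x => exists i, A i x))).

Definition locally_finite (n : nat) (mu : (Rn n -> Prop) -> ereal) : Prop :=
  forall x, exists U, is_open n U /\ U x /\ exists r, mu U = EFin r.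

Definition supp (n : nat) (mu : (Rn n -> Prop) -> ereal) (x : Rn n) : Prop :=
  forall U, is_open n U -> U x -> mu U <> EFin 0.

(* closed eps-neighbourhood of the affine hyperplane {y | a.y = c}: dist(x, L) <= eps *)
Definition hyp_nbhd (n : nat) (a : Rn n) (c eps : R) : Rn n -> Prop :=
  fun x => forall delta, 0 < delta -> exists y, dot n a y = c /\ dist n x y < eps + delta.

Definition abs_decaying_with (n : nat) (mu : (Rn n -> Prop) -> ereal) (C gamma : R) : Prop :=
  0 < C /\ 0 < gamma /\
  exists rho0, 0 < rho0 /\
    forall (a : Rn n) (c : R) (x : Rn n) (rho eps : R),
      (exists i, a i <> 0) ->
      supp n mu x -> 0 < rho -> rho < rho0 -> 0 < eps ->
      ere_lt (mu (fun z => cball n x rho z /\ hyp_nbhd n a c eps z))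
             (ere_scale (C * Rpower (eps / rho) gamma) (mu (cball n x rho))).

Definition absolutely_decaying (n : nat) (mu : (Rn n -> Prop) -> ereal) : Prop :=
  exists C gamma, abs_decaying_with n mu C gamma.

Definition in_ball (n : nat) (K : Rn n -> Prop) (w : Rn n * R) (z : Rn n) : Prop :=
  K z /\ dist n (fst w) z <= snd w.

Definition leS (n : nat) (w2 w1 : Rn n * R) : Prop :=
  snd w2 + dist n (fst w1) (fst w2) <= snd w1.

(* Alice's strategy: from Bob's moves omega_1..omega_k (as a list) it returns the
   center of omega'_k; its radius is forced to be alpha * rho_k. *)
Definition strategy (n : nat) := list (Rn n * R) -> Rn n.

(* b k is Bob's move omega_{k+1}; Alice's center at that stage *)
Definition alice_center (n : nat) (sigma : strategy n) (b : nat -> Rn n * R) (k : nat) : Rn n :=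
  sigma (map b (seq 0 (S k))).

Definition bob_start (n : nat) (K : Rn n -> Prop) (b : nat -> Rn n * R) : Prop :=
  K (fst (b 0%nat)) /\ 0 < snd (b 0%nat).

Definition alice_ok (n : nat) (K : Rn n -> Prop) (alpha : R) (sigma : strategy n)
  (b : nat -> Rn n * R) (k : nat) : Prop :=
  K (alice_center n sigma b k) /\
  leS n (alice_center n sigma b k, alpha * snd (b k)) (b k).

Definition bob_step_ok (n : nat) (K : Rn n -> Prop) (alpha beta : R) (sigma : strategy n)
  (b : nat -> Rn n * R) (j : nat) : Prop :=
  K (fst (b (S j))) /\
  snd (b (S j)) = beta * (alpha * snd (b j)) /\
  leS n (b (S j)) (alice_center n sigma b j, alpha * snd (b j)).

Definition ab_winning (n : nat) (K S : Rn n -> Prop) (alpha beta : R) : Prop :=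
  exists sigma : strategy n,
    (forall b k, bob_start n K b ->
       (forall j, (j < k)%nat -> bob_step_ok n K alpha beta sigma b j) ->
       alice_ok n K alpha sigma b k) /\
    (forall b, bob_start n K b ->
       (forall j, bob_step_ok n K alpha beta sigma b j) ->
       forall z, (forall k, in_ball n K (b k) z) -> S z /\ K z).

Definition alpha_winning (n : nat) (K S : Rn n -> Prop) (alpha : R) : Prop :=
  forall beta, 0 < beta < 1 -> ab_winning n K S alpha beta.

Definition Mat (n : nat) := Fin.t n -> Fin.t n -> R.

Definition mvec (n : nat) (M : Mat n) (x : Rn n) : Rn n :=
  fun i => fsum n (fun j => M i j * x j).

Definition mmul (n : nat) (M N : Mat n) : Mat n :=
  fun i k => fsum n (fun j => M i j * N j k).

Definition idm (n : nat) : Mat n :=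
  fun i j => if Fin.eq_dec i j then 1 else 0.

Definition integer_matrix (n : nat) (M : Mat n) : Prop :=
  forall i j, exists z : Z, M i j = IZR z.

Definition invertible (n : nat) (M : Mat n) : Prop :=
  exists N : Mat n, mmul n M N = idm n /\ mmul n N M = idm n.

(* represented by the fundamental domain [0,1)^n, with pi = componentwise fractional part *)
Definition Tn (n : nat) := { y : Rn n | forall i, y i >= 0 /\ y i < 1 }.

Definition pi (n : nat) (x : Rn n) : Tn n :=
  exist (fun y : Rn n => forall i, y i >= 0 /\ y i < 1) (fun i => frac_part (x i)) (fun i => base_fp (x i)).

(* quotient topology: U is open iff pi^{-1}(U) is open *)
Definition torus_open (n : nat) (U : Tn n -> Prop) : Prop :=
  is_open n (fun x => U (pi n x)).

Definition torus_closure (n : nat) (A : Tn n -> Prop) (y : Tn n) : Prop :=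
  forall U, torus_open n U -> U y -> exists s, A s /\ U s.

Definition Etilde (n : nat) (M : Mat n) (y : Tn n) : Rn n -> Prop :=
  fun x => ~ torus_closure n (fun t => exists k : nat, t = pi n (Nat.iter k (mvec n M) x)) y.

(* Main.v *)
(** Since [M] is an integer matrix, its minimal polynomial over the rationals has a nontrivial
    separable quotient, which annihilates some nonzero integer row vector [a]. Thus [a] is a sum
    of eigenvectors, and the norms of [v_k = a M^k] are comparable to [q^k], where [q] is the
    largest modulus of an eigenvalue involved. As [a] is integral, the orbit of [x] stays away
    from [y] as soon as the numbers [v_k . x - a . y] stay away from the integers. If [q > 1] the
    vectors [v_k] are lacunary; if [q <= 1] there are only finitely many of them. In both cases
    boundedly many of the relevant families of parallel hyperplanes become visible at each stage
    of the game.

    In a small ball centred on [K], absolute decay bounds the average weight of the hyperplane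
    neighbourhoods containing a point, so Alice can move to a point of [K] that escapes at least
    half of the total weight of the hyperplanes still threatening the ball. The hyperplane with
    normal [u], [|u|] of order [q^j], gets weight [(q^j rho)^(-eta)] in a ball of radius [rho],
    where [eta] makes the weight grow by [3/2] per round. The total weight then satisfies
    [Phi' <= 3/4 Phi + N] and stays bounded, so that no hyperplane threatens the ball for long. *)

From mathcomp Require all_boot all_order all_algebra all_field complex boolp Rstruct.
From Stdlib Require Import Reals List Lra Lia ZArith Cantor.
From Stdlib Require Import Classical ClassicalEpsilon.
From Stdlib Require Import FunctionalExtensionality PropExtensionality.
Require Import Defs.
Open Scope R_scope.

(** * Euclidean geometry *)

Lemma fsum_ext n (f g : Fin.t n -> R) : (forall i, f i = g i) -> fsum n f = fsum n g.
Proof. intros H; f_equal; extensionality i; apply H. Qed.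

Lemma fsum_plus n (f g : Fin.t n -> R) : fsum n (fun i => f i + g i) = fsum n f + fsum n g.
Proof. induction n as [|n IH]; simpl; [ring | rewrite IH; ring]. Qed.

Lemma fsum_scal n c (f : Fin.t n -> R) : fsum n (fun i => c * f i) = c * fsum n f.
Proof. induction n as [|n IH]; simpl; [ring | rewrite IH; ring]. Qed.

Lemma fsum_ge0 n (f : Fin.t n -> R) : (forall i, 0 <= f i) -> 0 <= fsum n f.
Proof.
  induction n as [|n IH]; simpl; intros H; [lra |].
  specialize (IH (fun i => f (Fin.FS i)) (fun i => H _)); specialize (H Fin.F1); lra.
Qed.

Lemma fsum_term_le n (f : Fin.t n -> R) i : (forall j, 0 <= f j) -> f i <= fsum n f.
Proof.
  induction i as [n|n i IH]; simpl; intros H.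
  - pose proof (fsum_ge0 n (fun i => f (Fin.FS i)) (fun i => H _)); lra.
  - specialize (IH (fun i => f (Fin.FS i)) (fun i => H _)); specialize (H Fin.F1); simpl in IH; lra.
Qed.

Lemma fsum_swap m n (f : Fin.t m -> Fin.t n -> R) :
  fsum m (fun i => fsum n (f i)) = fsum n (fun j => fsum m (fun i => f i j)).
Proof.
  induction m as [|m IH]; simpl.
  - clear f; induction n as [|n IHn]; simpl; [reflexivity | lra].
  - rewrite fsum_plus, IH; reflexivity.
Qed.

Definition normsq n (x : Rn n) : R := fsum n (fun i => x i ^ 2).
Definition norm n (x : Rn n) : R := sqrt (normsq n x).

Lemma normsq_ge0 n x : 0 <= normsq n x.
Proof. apply fsum_ge0; intros; nra. Qed.

Lemma norm_ge0 n x : 0 <= norm n x.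
Proof. apply sqrt_pos. Qed.

Lemma norm_sq n x : norm n x * norm n x = normsq n x.
Proof. apply sqrt_sqrt, normsq_ge0. Qed.

Lemma norm_gt0 n x : (exists i, x i <> 0) -> 0 < norm n x.
Proof.
  intros [i Hi]; apply sqrt_lt_R0.
  apply Rlt_le_trans with (x i ^ 2); [nra |].
  apply (fsum_term_le n (fun i => x i ^ 2)); intros; nra.
Qed.

Lemma coord_le_norm n x i : Rabs (x i) <= norm n x.
Proof.
  rewrite <- sqrt_Rsqr_abs; apply sqrt_le_1_alt; unfold Rsqr.
  pose proof (fsum_term_le n (fun i => x i ^ 2) i (fun j => pow2_ge_0 _)).
  simpl in H; unfold normsq; simpl; lra.
Qed.

Lemma dist_norm n x y : dist n x y = norm n (fun i => x i - y i).
Proof. reflexivity. Qed.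

Lemma dot_plus n a x y : dot n a (fun i => x i + y i) = dot n a x + dot n a y.
Proof.
  unfold dot; rewrite <- fsum_plus; apply fsum_ext; intros; ring.
Qed.

Lemma dot_scal n a c x : dot n a (fun i => c * x i) = c * dot n a x.
Proof. unfold dot; rewrite <- fsum_scal; apply fsum_ext; intros; ring. Qed.

Lemma dot_minus n a x y : dot n a (fun i => x i - y i) = dot n a x - dot n a y.
Proof.
  replace (fun i => x i - y i) with (fun i => x i + (-1) * y i)
    by (extensionality i; ring).
  rewrite dot_plus, dot_scal; ring.
Qed.

Lemma dot_self n x : dot n x x = normsq n x.
Proof. apply fsum_ext; intros; ring. Qed.

Lemma normsq_plus_scal n a t b :
  normsq n (fun i => a i + t * b i) = normsq n a + 2 * t * dot n a b + t * t * normsq n b.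
Proof.
  unfold normsq, dot; rewrite <- !fsum_scal, <- !fsum_plus; apply fsum_ext; intros; ring.
Qed.

(** The polynomial [|a - t b|^2] in [t] is nonnegative; it is evaluated at its minimiser
    [t = D / B]. If [B = 0] it is affine in [t], and a nonzero slope would let it reach [-1]. *)
Lemma cauchy_schwarz_sq n a b : dot n a b * dot n a b <= normsq n a * normsq n b.
Proof.
  set (A := normsq n a); set (B := normsq n b); set (D := dot n a b).
  assert (H : forall t, 0 <= A - 2 * t * D + t * t * B).
  { intros t; pose proof (normsq_ge0 n (fun i => a i + (- t) * b i)) as H.
    rewrite normsq_plus_scal in H; fold A B D in H; lra. }
  assert (0 <= B) by apply normsq_ge0.
  destruct (Req_dec B 0) as [HB|HB].
  - destruct (Req_dec D 0) as [HD|HD]; [rewrite HD, HB; lra |].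
    specialize (H ((A + 1) / (2 * D))); rewrite HB in H.
    replace (A - 2 * ((A + 1) / (2 * D)) * D + (A + 1) / (2 * D) * ((A + 1) / (2 * D)) * 0)
      with (-1) in H by (field; auto); lra.
  - specialize (H (D / B)).
    replace (A - 2 * (D / B) * D + D / B * (D / B) * B) with ((A * B - D * D) / B) in H
      by (field; auto).
    assert (0 <= (A * B - D * D) / B * B) by (apply Rmult_le_pos; lra).
    replace ((A * B - D * D) / B * B) with (A * B - D * D) in * by (field; auto); lra.
Qed.

Lemma cauchy_schwarz n a b : Rabs (dot n a b) <= norm n a * norm n b.
Proof.
  rewrite <- sqrt_Rsqr_abs; unfold norm.
  rewrite <- sqrt_mult by apply normsq_ge0.
  apply sqrt_le_1_alt, cauchy_schwarz_sq.
Qed.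

Lemma norm_plus n x y : norm n (fun i => x i + y i) <= norm n x + norm n y.
Proof.
  pose proof (norm_ge0 n x); pose proof (norm_ge0 n y).
  pose proof (norm_ge0 n (fun i => x i + y i)).
  apply Rsqr_incr_0_var; [unfold Rsqr | lra].
  rewrite norm_sq.
  replace (fun i => x i + y i) with (fun i => x i + 1 * y i) by (extensionality i; ring).
  rewrite normsq_plus_scal.
  pose proof (cauchy_schwarz n x y); pose proof (Rle_abs (dot n x y)).
  rewrite <- !norm_sq; nra.
Qed.

Lemma norm_scal n c x : norm n (fun i => c * x i) = Rabs c * norm n x.
Proof.
  unfold norm, normsq; rewrite <- (sqrt_Rsqr_abs c), <- sqrt_mult_alt by apply Rle_0_sqr.
  f_equal; rewrite <- fsum_scal; apply fsum_ext; intros; unfold Rsqr; ring.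
Qed.

Lemma dist_sym n x y : dist n x y = dist n y x.
Proof. unfold dist; f_equal; apply fsum_ext; intros; ring. Qed.

Lemma dist_triangle n x y z : dist n x z <= dist n x y + dist n y z.
Proof.
  rewrite !dist_norm; eapply Rle_trans; [| apply norm_plus]; right; f_equal.
  extensionality i; ring.
Qed.

Lemma dist_ge0 n x y : 0 <= dist n x y.
Proof. apply sqrt_pos. Qed.

Lemma dist_refl n x : dist n x x = 0.
Proof.
  unfold dist; replace (fsum n _) with 0; [apply sqrt_0 |].
  symmetry; transitivity (fsum n (fun i => 0 * x i)); [apply fsum_ext; intros; ring |].
  rewrite fsum_scal; ring.
Qed.

Lemma dot_lipschitz n a x y : Rabs (dot n a x - dot n a y) <= norm n a * dist n x y.
Proof. rewrite <- dot_minus, dist_norm; apply cauchy_schwarz. Qed.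

Lemma norm_le_sum n x : norm n x <= fsum n (fun i => Rabs (x i)).
Proof.
  unfold norm, normsq; induction n as [|n IH]; simpl; [rewrite sqrt_0; lra |].
  specialize (IH (fun i => x (Fin.FS i))).
  set (P := fsum n (fun i => Rabs (x (Fin.FS i)))) in *.
  pose proof (normsq_ge0 n (fun i => x (Fin.FS i))) as HN.
  unfold normsq in HN; simpl in *.
  set (N := fsum n (fun i => x (Fin.FS i) * (x (Fin.FS i) * 1))) in *.
  pose proof (sqrt_pos N); pose proof (Rabs_pos (x Fin.F1)).
  apply Rsqr_incr_0_var; [| lra].
  rewrite Rsqr_sqrt by nra; unfold Rsqr.
  pose proof (sqrt_sqrt N HN).
  assert (x Fin.F1 * x Fin.F1 = Rabs (x Fin.F1) * Rabs (x Fin.F1))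
    by (rewrite <- Rabs_mult, Rabs_right; nra).
  nra.
Qed.

Lemma sum_le_norm n x : fsum n (fun i => Rabs (x i)) <= INR n * norm n x.
Proof.
  assert (H : forall B, (forall i, Rabs (x i) <= B) -> fsum n (fun i => Rabs (x i)) <= INR n * B).
  { induction n as [|n IH]; intros B HB; [simpl; lra |].
    rewrite S_INR; simpl fsum.
    specialize (IH (fun i => x (Fin.FS i)) B (fun i => HB _)); specialize (HB Fin.F1); simpl in IH; lra. }
  apply H; intros; apply coord_le_norm.
Qed.

(** The orthogonal projection of [z] to the hyperplane is [z - t a] with [t = (a.z - c) / |a|^2], at
    distance [|a.z - c| / |a|]. This turns decay of neighbourhoods into decay of slabs, which are
    easier to follow through the game. *)
Lemma hyp_nbhd_slab n a c eps z : (exists i, a i <> 0) ->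
  Rabs (dot n a z - c) <= eps * norm n a -> hyp_nbhd n a c eps z.
Proof.
  intros Ha H delta Hd; apply norm_gt0 in Ha.
  set (t := (dot n a z - c) / normsq n a).
  assert (Hsq : 0 < normsq n a) by (rewrite <- norm_sq; nra).
  exists (fun i => z i - t * a i); split.
  - rewrite dot_minus, dot_scal, dot_self; unfold t; field; lra.
  - rewrite dist_norm; replace (fun i => z i - (z i - t * a i)) with (fun i => t * a i)
      by (extensionality i; ring).
    rewrite norm_scal; unfold t, Rdiv; rewrite Rabs_mult, Rabs_inv, (Rabs_right (normsq n a)) by lra.
    rewrite <- norm_sq, Rinv_mult.
    apply Rle_lt_trans with eps; [| lra].
    apply Rmult_le_reg_r with (norm n a); [lra |].
    replace (Rabs (dot n a z - c) * (/ norm n a * / norm n a) * norm n a)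
      with (Rabs (dot n a z - c) * / norm n a) by (field; lra).
    apply Rmult_le_reg_r with (norm n a); [lra |].
    replace (Rabs (dot n a z - c) * / norm n a * norm n a) with (Rabs (dot n a z - c)) by (field; lra).
    nra.
Qed.

Lemma dot_mvec n M a x : dot n a (mvec n M x) = dot n (mvec n (fun i j => M j i) a) x.
Proof.
  unfold dot, mvec.
  transitivity (fsum n (fun i => fsum n (fun j => a i * M i j * x j))).
  - apply fsum_ext; intros i; rewrite <- fsum_scal; apply fsum_ext; intros; ring.
  - rewrite fsum_swap; apply fsum_ext; intros j.
    rewrite (Rmult_comm _ (x j)), <- fsum_scal; apply fsum_ext; intros; ring.
Qed.

(** Moves the dynamics from the point to the linear form, so that the orbit of [x] is seen through a
    sequence of fixed hyperplane families. *)
Lemma dot_iter_mvec n M a x k :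
  dot n a (Nat.iter k (mvec n M) x) = dot n (Nat.iter k (mvec n (fun i j => M j i)) a) x.
Proof.
  revert a; induction k as [|k IH]; intros a; [reflexivity |].
  rewrite Nat.iter_succ, dot_mvec, IH, Nat.iter_succ_r; reflexivity.
Qed.

(** Separability is needed to cover the complement of a support by countably many null balls. *)
Lemma dense_sequence n : exists e : nat -> Rn n,
  forall x eps, 0 < eps -> exists i, dist n x (e i) < eps.
Proof.
  assert (HQ : exists q : nat -> R, forall x eps, 0 < eps -> exists i, Rabs (x - q i) < eps).
  (* One natural number encodes a rational: the numerator is a difference of two naturals and the
     denominator a successor, hence never zero. *)
  { exists (fun k => let (a, bc) := Cantor.of_nat k in let (b, c) := Cantor.of_nat bc in
             (INR a - INR b) / INR (S c)).
    intros x eps He.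
    destruct (archimed_cor1 eps He) as [N [HN HN0]].
    assert (Hz : 0 < INR N) by (apply lt_0_INR; lia).
    set (z := up (x * INR N)).
    destruct (archimed (x * INR N)) as [Hz1 Hz2]; fold z in Hz1, Hz2.
    exists (Cantor.to_nat (Z.to_nat z, Cantor.to_nat (Z.to_nat (- z), pred N))).
    rewrite !Cantor.cancel_of_to.
    replace (S (pred N)) with N by lia.
    assert (HzE : INR (Z.to_nat z) - INR (Z.to_nat (- z)) = IZR z).
    { rewrite !INR_IZR_INZ, <- minus_IZR; f_equal; lia. }
    rewrite HzE.
    apply Rle_lt_trans with (/ INR N); [| lra].
    replace (x - IZR z / INR N) with ((x * INR N - IZR z) * / INR N) by (field; lra).
    pose proof (Rinv_0_lt_compat _ Hz).
    rewrite Rabs_mult, (Rabs_right (/ INR N)) by lra.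
    rewrite <- (Rmult_1_l (/ INR N)) at 2.
    apply Rmult_le_compat_r; [lra |]; apply Rabs_le; lra. }
  destruct HQ as [q Hq].
  induction n as [|n [e He]].
  - exists (fun _ => fun _ => 0); intros x eps Heps; exists 0%nat.
    unfold dist; simpl; rewrite sqrt_0; lra.
  - exists (fun k => let (a, b) := Cantor.of_nat k in
              fun i => Fin.caseS' i (fun _ => R) (q a) (e b)).
    intros x eps Heps.
    destruct (Hq (x Fin.F1) (eps / 2)) as [a Ha]; [lra |].
    destruct (He (fun i => x (Fin.FS i)) (eps / 2)) as [b Hb]; [lra |].
    exists (Cantor.to_nat (a, b)); rewrite Cantor.cancel_of_to.
    unfold dist in *; simpl in *.
    match goal with |- sqrt (?u * (?u * 1) + ?N) < _ => set (U := u) in *; set (V := N) in * end.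
    assert (HV : 0 <= V).
    { apply fsum_ge0; intros i; apply (pow2_ge_0 (x (Fin.FS i) - e b i)). }
    pose proof (sqrt_pos V).
    apply Rle_lt_trans with (Rabs U + sqrt V); [| lra].
    pose proof (Rabs_pos U).
    apply Rsqr_incr_0_var; [| lra].
    rewrite Rsqr_sqrt by nra; unfold Rsqr.
    pose proof (sqrt_sqrt V HV).
    assert (U * U = Rabs U * Rabs U) by (rewrite <- Rabs_mult, Rabs_right; nra).
    nra.
Qed.

(** * Measures *)

Lemma pred_ext (T : Type) (A B : T -> Prop) : (forall x, A x <-> B x) -> A = B.
Proof. intros H; extensionality x; apply propositional_extensionality, H. Qed.

Lemma borel_open n U : is_open n U -> borel n U.
Proof. intros H F _ HF; auto. Qed.

Lemma borel_compl n A : borel n A -> borel n (fun x => ~ A x).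
Proof. intros H F HF HU; apply HF, H; auto. Qed.

Lemma borel_union n (A : nat -> Rn n -> Prop) :
  (forall i, borel n (A i)) -> borel n (fun x => exists i, A i x).
Proof. intros H F HF HU; apply HF; intros i; apply H; auto. Qed.

Lemma borel_closed n A : is_open n (fun x => ~ A x) -> borel n A.
Proof.
  intros H; replace A with (fun x => ~ ~ A x); [apply borel_compl, borel_open, H |].
  apply pred_ext; intros; split; [apply NNPP | tauto].
Qed.

Lemma borel_empty n : borel n (fun _ => False).
Proof. apply borel_open; intros x []. Qed.

Lemma borel_or n A B : borel n A -> borel n B -> borel n (fun x => A x \/ B x).
Proof.
  intros HA HB.
  replace (fun x => A x \/ B x)
    with (fun x => exists i : nat, (match i with 0%nat => A | _ => B end) x).
  - apply borel_union; intros [|i]; assumption.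
  - apply pred_ext; intros x; split.
    + intros [[|i] H]; auto.
    + intros [H|H]; [exists 0%nat | exists 1%nat]; exact H.
Qed.

Lemma borel_and n A B : borel n A -> borel n B -> borel n (fun x => A x /\ B x).
Proof.
  intros HA HB; replace (fun x => A x /\ B x) with (fun x => ~ (~ A x \/ ~ B x)).
  - apply borel_compl, borel_or; apply borel_compl; assumption.
  - apply pred_ext; intros x; tauto.
Qed.

Lemma borel_cball n x r : borel n (cball n x r).
Proof.
  apply borel_closed; intros y Hy; unfold cball in *.
  exists (dist n x y - r); split; [lra |]; intros z Hz.
  pose proof (dist_triangle n x z y); rewrite (dist_sym n z y) in *; lra.
Qed.

Lemma borel_hyp_nbhd n a c eps : borel n (hyp_nbhd n a c eps).
Proof.
  apply borel_closed; intros z Hz; unfold hyp_nbhd in *.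
  apply not_all_ex_not in Hz; destruct Hz as [d Hz].
  apply imply_to_and in Hz; destruct Hz as [Hd Hz].
  exists (d / 2); split; [lra |]; intros w Hw Hall.
  destruct (Hall (d / 2)) as [y [Hy1 Hy2]]; [lra |].
  apply Hz; exists y; split; [exact Hy1 |].
  pose proof (dist_triangle n z w y); lra.
Qed.

Lemma open_compl_supp n mu : is_open n (fun x => ~ supp n mu x).
Proof.
  intros x Hx; unfold supp in Hx.
  apply not_all_ex_not in Hx; destruct Hx as [U HU].
  assert (HO : is_open n U) by tauto; assert (Ux : U x) by tauto.
  destruct (HO x Ux) as [r [Hr Hball]]; exists r; split; [exact Hr |].
  intros z Hz Hs; apply (Hs U HO (Hball z Hz)); tauto.
Qed.

Section Measure.
Variables (n : nat) (mu : (Rn n -> Prop) -> ereal).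
Hypothesis (Hmu : is_measure n mu).

(** Countable additivity is applied to the two pieces followed by empty sets. Both pieces are finite
    because a finite [esum_is] forces every term to be finite. *)
Lemma measure_split A B b : borel n A -> borel n B -> mu B = EFin b ->
  exists b1 b2, mu (fun x => B x /\ A x) = EFin b1 /\ mu (fun x => B x /\ ~ A x) = EFin b2 /\
    b = b1 + b2 /\ 0 <= b1 /\ 0 <= b2.
Proof.
  destruct Hmu as [_ [Hpos [H0 Hadd]]]; intros HA HB Hb.
  assert (B1 : borel n (fun x => B x /\ A x)) by (apply borel_and; auto).
  assert (B2 : borel n (fun x => B x /\ ~ A x)) by (apply borel_and, borel_compl; auto).
  pose (S := fun i : nat => match i with
    | 0%nat => fun x => B x /\ A x | 1%nat => fun x => B x /\ ~ A x | _ => fun _ => False end).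
  specialize (Hadd S).
  replace (fun x => exists i, S i x) with B in Hadd.
  2:{ apply pred_ext; intros x; split.
      - intros Bx; destruct (classic (A x)); [exists 0%nat | exists 1%nat]; simpl; auto.
      - intros [[|[|i]] H]; simpl in H; tauto. }
  rewrite Hb in Hadd; simpl in Hadd.
  destruct Hadd as [g [Hg Hcv]].
  { intros [|[|i]]; simpl; auto; apply borel_empty. }
  { intros [|[|i]] [|[|j]] x; simpl; intros; try tauto; lia. }
  exists (g 0%nat), (g 1%nat).
  pose proof (Hg 0%nat) as G0; pose proof (Hg 1%nat) as G1; simpl in G0, G1.
  pose proof (Hpos _ B1) as P1; pose proof (Hpos _ B2) as P2; rewrite G0 in P1; rewrite G1 in P2.
  repeat split; auto.
  assert (Hs : forall N, sum_f_R0 g (N + 1) = g 0%nat + g 1%nat).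
  { induction N as [|N IH]; [reflexivity |].
    simpl; rewrite IH; pose proof (Hg (N + 1 + 1)%nat) as E.
    replace (S (N + 1 + 1)%nat) with (fun _ : Rn n => False) in E
      by (replace (N + 1 + 1)%nat with (Datatypes.S (Datatypes.S N)) by lia; reflexivity).
    rewrite H0 in E; injection E as E.
    replace (Datatypes.S (N + 1)) with (N + 1 + 1)%nat by lia; lra. }
  apply (UL_sequence (fun N => sum_f_R0 g N)); [exact Hcv |].
  intros eps He; exists 1%nat; intros N HN.
  replace N with (N - 1 + 1)%nat by lia; rewrite Hs.
  unfold Rdist; rewrite Rminus_diag, Rabs_R0; lra.
Qed.

Lemma measure_sub A B b : borel n A -> borel n B -> (forall x, A x -> B x) -> mu B = EFin b ->
  exists a, mu A = EFin a /\ 0 <= a <= b.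
Proof.
  intros HA HB Hsub Hb; destruct (measure_split A B b HA HB Hb) as [b1 [b2 [E1 [E2 H]]]].
  exists b1; split; [| lra].
  rewrite <- E1; f_equal; apply pred_ext; intros x; split; [auto | tauto].
Qed.

(** The sets are made disjoint by removing from each one its predecessors; the pieces remain null,
    so every partial sum vanishes. *)
Lemma measure_null_union (A : nat -> Rn n -> Prop) :
  (forall i, borel n (A i)) -> (forall i, mu (A i) = EFin 0) ->
  mu (fun x => exists i, A i x) = EFin 0.
Proof.
  intros HA H0; destruct Hmu as [_ [_ [_ Hadd]]].
  pose (D := fun i x => A i x /\ ~ exists j, (j < i)%nat /\ A j x).
  assert (HD : forall i, borel n (D i)).
  { intros i; apply borel_and; [apply HA |]; apply borel_compl, borel_union; intros j.
    destruct (classic (j < i)%nat).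
    - replace (fun x => (j < i)%nat /\ A j x) with (A j); [apply HA |].
      apply pred_ext; tauto.
    - replace (fun x => (j < i)%nat /\ A j x) with (fun _ : Rn n => False);
        [apply borel_empty |].
      apply pred_ext; tauto. }
  assert (D0 : forall i, mu (D i) = EFin 0).
  { intros i; destruct (measure_sub (D i) (A i) 0 (HD i) (HA i)) as [d [E Hd]].
    - intros x [H _]; exact H.
    - apply H0.
    - rewrite E; f_equal; lra. }
  specialize (Hadd D HD).
  replace (fun x => exists i, A i x) with (fun x => exists i, D i x).
  2:{ apply pred_ext; intros x; split.
      - intros [i [H _]]; exists i; exact H.
      - intros [i H]; revert H; induction i as [i IH] using (well_founded_induction lt_wf).
        intros H; destruct (classic (exists j, (j < i)%nat /\ A j x)) as [[j [Hj Hx]]|Hn].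
        + apply (IH j Hj Hx).
        + exists i; split; assumption. }
  assert (Hsum : forall g : nat -> R, (forall i, mu (D i) = EFin (g i)) ->
    forall N, sum_f_R0 g N = 0).
  { intros g Hg; assert (G : forall i, g i = 0).
    { intros i; specialize (Hg i); rewrite D0 in Hg; injection Hg; auto. }
    induction N as [|N IH]; simpl; rewrite ?IH, G; lra. }
  destruct (mu (fun x => exists i, D i x)) as [l|]; simpl in Hadd.
  - destruct Hadd as [g [Hg Hcv]].
    { intros i j x Hij [Hi Ni] [Hj Nj].
      destruct (Nat.lt_trichotomy i j) as [H|[H|H]]; [apply Nj; eauto | auto | apply Ni; eauto]. }
    f_equal; apply (UL_sequence (fun N => sum_f_R0 g N)); [exact Hcv |].
    intros eps He; exists 0%nat; intros N _; rewrite Hsum by exact Hg.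
    unfold Rdist; rewrite Rminus_diag, Rabs_R0; lra.
  - destruct Hadd as [[i Hi]|[g [Hg Hcv]]].
    { intros i j x Hij [Hi Ni] [Hj Nj].
      destruct (Nat.lt_trichotomy i j) as [H|[H|H]]; [apply Nj; eauto | auto | apply Ni; eauto]. }
    + rewrite D0 in Hi; discriminate.
    + destruct (Hcv 1) as [N HN]; specialize (HN N (le_n _)).
      rewrite Hsum in HN by exact Hg; lra.
Qed.

(** A point outside the support has a null open neighbourhood, which contains a ball around that
    point with centre in the dense sequence and radius the inverse of an integer. Countably many
    such null balls therefore cover the complement. *)
Lemma measure_compl_supp : mu (fun x => ~ supp n mu x) = EFin 0.
Proof.
  destruct (dense_sequence n) as [e He].
  pose (ball := fun k => let (i, m) := Cantor.of_nat k in
                fun z : Rn n => dist n (e i) z < / INR (S m)).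
  assert (Hball : forall k, is_open n (ball k)).
  { intros k; unfold ball; destruct (Cantor.of_nat k) as [i m]; intros z Hz.
    exists (/ INR (S m) - dist n (e i) z); split; [lra |]; intros w Hw.
    pose proof (dist_triangle n (e i) z w); lra. }
  (* Balls that are not null are replaced by the empty set, so that the union can run over all
     indices. *)
  pose (N := fun k x => mu (ball k) = EFin 0 /\ ball k x).
  replace (fun x => ~ supp n mu x) with (fun x => exists k, N k x).
  - apply measure_null_union; intros k; unfold N;
      destruct (classic (mu (ball k) = EFin 0)) as [E|E].
    + replace (fun x => mu (ball k) = EFin 0 /\ ball k x) with (ball k)
        by (apply pred_ext; tauto).
      apply borel_open, Hball.
    + replace (fun x => mu (ball k) = EFin 0 /\ ball k x) with (fun _ : Rn n => False)
        by (apply pred_ext; tauto).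
      apply borel_empty.
    + replace (fun x => mu (ball k) = EFin 0 /\ ball k x) with (ball k)
        by (apply pred_ext; tauto).
      exact E.
    + replace (fun x => mu (ball k) = EFin 0 /\ ball k x) with (fun _ : Rn n => False)
        by (apply pred_ext; tauto).
      apply Hmu.
  - apply pred_ext; intros x; split.
    + intros [k [E Hk]] Hs; apply (Hs (ball k)); auto.
    + intros Hx; unfold supp in Hx.
      apply not_all_ex_not in Hx; destruct Hx as [U HU].
      assert (HO : is_open n U) by tauto; assert (Ux : U x) by tauto.
      assert (U0 : mu U = EFin 0) by tauto.
      destruct (HO x Ux) as [r [Hr HrU]].
      destruct (archimed_cor1 (r / 2)) as [m [Hm Hm0]]; [lra |].
      assert (Hp : 0 < / INR m) by (apply Rinv_0_lt_compat, lt_0_INR; lia).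
      destruct (He x (/ INR m) Hp) as [i Hi].
      exists (Cantor.to_nat (i, pred m)).
      assert (Eb : ball (Cantor.to_nat (i, pred m)) = fun z => dist n (e i) z < / INR m).
      { unfold ball; rewrite Cantor.cancel_of_to; replace (S (pred m)) with m by lia; auto. }
      split.
      * destruct (measure_sub (ball (Cantor.to_nat (i, pred m))) U 0) as [a [Ea Ha]]; auto.
        -- apply borel_open, Hball.
        -- apply borel_open, HO.
        -- rewrite Eb; intros z Hz; apply HrU.
           pose proof (dist_triangle n x (e i) z); lra.
        -- rewrite Ea; f_equal; lra.
      * rewrite Eb, dist_sym; exact Hi.
Qed.

End Measure.

(** * Finite weighted sums and indicators *)

Fixpoint nsum (f : nat -> R) (J : nat) : R :=
  match J with O => 0 | S J => nsum f J + f J end.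

Definition ind (P : Prop) : R := if excluded_middle_informative P then 1 else 0.

Lemma ind_true (P : Prop) : P -> ind P = 1.
Proof. intros; unfold ind; destruct excluded_middle_informative; tauto. Qed.

Lemma ind_false (P : Prop) : ~ P -> ind P = 0.
Proof. intros; unfold ind; destruct excluded_middle_informative; tauto. Qed.

Lemma ind_bounds (P : Prop) : 0 <= ind P <= 1.
Proof. unfold ind; destruct excluded_middle_informative; lra. Qed.

Lemma ind_le (P Q : Prop) : (P -> Q) -> ind P <= ind Q.
Proof. intros; unfold ind; do 2 destruct excluded_middle_informative; tauto || lra. Qed.

Lemma nsum_le f g J : (forall j, (j < J)%nat -> f j <= g j) -> nsum f J <= nsum g J.
Proof.
  induction J as [|J IH]; simpl; intros H; [lra |].
  pose proof (H J ltac:(lia)); specialize (IH (fun j Hj => H j ltac:(lia))); lra.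
Qed.

Lemma nsum_lt f g J : (forall j, (j < J)%nat -> f j <= g j) ->
  (exists j, (j < J)%nat /\ f j < g j) -> nsum f J < nsum g J.
Proof.
  induction J as [|J IH]; simpl; intros H [j [Hj Hlt]]; [lia |].
  pose proof (H J ltac:(lia)).
  destruct (Nat.eq_dec j J) as [->|Hne].
  - pose proof (nsum_le f g J (fun j Hj => H j ltac:(lia))); lra.
  - assert (nsum f J < nsum g J); [| lra].
    apply IH; [intros; apply H; lia | exists j; split; [lia | exact Hlt]].
Qed.

Lemma nsum_ext f g J : (forall j, (j < J)%nat -> f j = g j) -> nsum f J = nsum g J.
Proof. intros H; apply Rle_antisym; apply nsum_le; intros j Hj; rewrite (H j Hj); lra. Qed.

Lemma nsum_plus f g J : nsum (fun j => f j + g j) J = nsum f J + nsum g J.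
Proof. induction J as [|J IH]; simpl; [lra | rewrite IH; lra]. Qed.

Lemma nsum_scal c f J : nsum (fun j => c * f j) J = c * nsum f J.
Proof. induction J as [|J IH]; simpl; [lra | rewrite IH; lra]. Qed.

Lemma nsum_const c J : nsum (fun _ => c) J = INR J * c.
Proof. induction J as [|J IH]; [simpl; lra | rewrite S_INR; simpl nsum; rewrite IH; lra]. Qed.

Lemma nsum_ge0 f J : (forall j, (j < J)%nat -> 0 <= f j) -> 0 <= nsum f J.
Proof.
  intros H; pose proof (nsum_le (fun _ => 0) f J H) as H1; rewrite nsum_const in H1; lra.
Qed.

Lemma nsum_term_le f J j : (forall i, (i < J)%nat -> 0 <= f i) -> (j < J)%nat -> f j <= nsum f J.
Proof.
  induction J as [|J IH]; simpl; intros H Hj; [lia |].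
  pose proof (nsum_ge0 f J (fun i Hi => H i ltac:(lia))).
  destruct (Nat.eq_dec j J) as [->|Hne]; [lra |].
  specialize (IH (fun i Hi => H i ltac:(lia)) ltac:(lia)); specialize (H J ltac:(lia)); lra.
Qed.

(** * Escaping hyperplane neighbourhoods inside the support of a decaying measure *)

Section Decay.
Variables (n : nat) (mu : (Rn n -> Prop) -> ereal) (C gamma rho0 : R).
Hypothesis (Hmu : is_measure n mu).

(* Junk value [0] on sets of infinite measure. *)
Definition mval (A : Rn n -> Prop) : R := match mu A with EFin r => r | EInf => 0 end.

(** Markov's inequality for the simple function with coefficients [w j] on the sets [A j], obtained
    without integration. The last set splits [E]; on the part inside it the threshold drops to
    [t - w J]. Hence the induction keeps [E] and [t] general. *)
Lemma weighted_markov (w : nat -> R) (A : nat -> Rn n -> Prop) J :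
  (forall j, borel n (A j)) -> forall E t b, borel n E -> mu E = EFin b ->
  (forall z, E z -> t <= nsum (fun j => w j * ind (A j z)) J) ->
  t * b <= nsum (fun j => w j * mval (fun z => E z /\ A j z)) J.
Proof.
  intros HA; induction J as [|J IH]; intros E t b HE Hb Ht; simpl in *.
  - destruct (classic (exists z, E z)) as [[z Hz]|Hn].
    + specialize (Ht z Hz); pose proof (proj1 (proj2 Hmu) E HE) as Hp; rewrite Hb in Hp; nra.
    + replace E with (fun _ : Rn n => False) in Hb by (apply pred_ext; firstorder).
      rewrite (proj1 (proj2 (proj2 Hmu))) in Hb; injection Hb as <-; lra.
  - destruct (measure_split n mu Hmu (A J) E b (HA J) HE Hb) as [b1 [b2 [E1 [E2 [Hs [P1 P2]]]]]].
    assert (BE1 : borel n (fun z => E z /\ A J z)) by (apply borel_and; auto).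
    assert (BE2 : borel n (fun z => E z /\ ~ A J z)) by (apply borel_and, borel_compl; auto).
    assert (H1 := IH _ (t - w J) b1 BE1 E1).
    assert (H2 := IH _ t b2 BE2 E2).
    unfold mval at 2; rewrite E1.
    rewrite (nsum_ext (fun j => w j * mval (fun z => E z /\ A j z))
      (fun j => w j * mval (fun z => (E z /\ A J z) /\ A j z)
              + w j * mval (fun z => (E z /\ ~ A J z) /\ A j z))).
    + rewrite nsum_plus.
      assert (H3 : (t - w J) * b1 <= nsum (fun j => w j * mval (fun z => (E z /\ A J z) /\ A j z)) J).
      { apply H1; intros z [Hz HAz]; specialize (Ht z Hz); rewrite (ind_true _ HAz) in Ht; lra. }
      assert (H4 : t * b2 <= nsum (fun j => w j * mval (fun z => (E z /\ ~ A J z) /\ A j z)) J).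
      { apply H2; intros z [Hz HAz]; specialize (Ht z Hz); rewrite (ind_false _ HAz) in Ht; lra. }
      subst b; lra.
    + intros j _; rewrite <- Rmult_plus_distr_l; f_equal.
      destruct (measure_sub n mu Hmu (fun z => E z /\ A j z) E b) as [a [Ea _]]; auto.
      { apply borel_and; auto. }
      { tauto. }
      destruct (measure_split n mu Hmu (A J) (fun z => E z /\ A j z) a) as [a1 [a2 [F1 [F2 [Fs _]]]]]; auto.
      { apply borel_and; auto. }
      unfold mval; rewrite Ea.
      replace (fun z => (E z /\ A J z) /\ A j z) with (fun z => (E z /\ A j z) /\ A J z)
        by (apply pred_ext; tauto).
      replace (fun z => (E z /\ ~ A J z) /\ A j z) with (fun z => (E z /\ A j z) /\ ~ A J z)
        by (apply pred_ext; tauto).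
      rewrite F1, F2; exact Fs.
Qed.

Hypothesis (HC : 0 < C).
Hypothesis (Hdecay : forall (a : Rn n) (c : R) (x : Rn n) (rho eps : R),
  (exists i, a i <> 0) -> supp n mu x -> 0 < rho -> rho < rho0 -> 0 < eps ->
  ere_lt (mu (fun z => cball n x rho z /\ hyp_nbhd n a c eps z))
         (ere_scale (C * Rpower (eps / rho) gamma) (mu (cball n x rho)))).

(* A huge neighbourhood of a hyperplane through the centre contains the whole ball, so the
   strict decay inequality already excludes infinite measure. *)
Lemma decaying_ball_finite (a : Rn n) x r : (exists i, a i <> 0) ->
  supp n mu x -> 0 < r < rho0 -> exists b, mu (cball n x r) = EFin b /\ 0 < b.
Proof.
  intros Ha Hx Hr.
  pose proof (Hdecay a (dot n a x) x r (r + 1) Ha Hx (proj1 Hr) (proj2 Hr) ltac:(lra)) as H.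
  replace (fun z => cball n x r z /\ hyp_nbhd n a (dot n a x) (r + 1) z) with (cball n x r) in H.
  2:{ apply pred_ext; intros z; split; [| tauto]; intros Hz; split; [exact Hz |].
      intros d Hd; exists x; split; [reflexivity |].
      unfold cball in Hz; rewrite dist_sym; lra. }
  destruct (mu (cball n x r)) as [b|] eqn:E; simpl in H; [| tauto].
  exists b; split; [reflexivity |].
  pose proof (proj1 (proj2 Hmu) _ (borel_cball n x r)) as Hp; rewrite E in Hp.
  destruct (Req_dec b 0) as [->|]; lra.
Qed.

(** If every point of the support in the ball carried more than [kap] times the total weight,
    [weighted_markov] would contradict the strict decay inequality summed over the hyperplanes.
    Normals have to be nonzero only where the weight is, because callers give weight zero to
    harmless indices. *)
Lemma avoid_hyperplanes (a : nat -> Rn n) (c w : nat -> R) J x r eps :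
  supp n mu x -> 0 < r < rho0 -> 0 < eps ->
  (forall j, 0 <= w j) -> (forall j, w j <> 0 -> exists i, a j i <> 0) ->
  exists z, supp n mu z /\ dist n x z <= r /\
    nsum (fun j => w j * ind (Rabs (dot n (a j) z - c j) <= eps * norm n (a j))) J
    <= C * Rpower (eps / r) gamma * nsum w J.
Proof.
  intros Hx Hr He Hw Ha; set (kap := C * Rpower (eps / r) gamma).
  assert (Hk : 0 < kap) by (apply Rmult_lt_0_compat; [exact HC | apply exp_pos]).
  destruct (classic (exists j, (j < J)%nat /\ 0 < w j)) as [[j0 [Hj0 Hwj0]]|Hn].
  (* Without a positive weight the centre itself works. Otherwise the normal [a j0] is nonzero and
     finiteness of the ball's measure follows. *)
  2:{ exists x; split; [exact Hx |]; split; [rewrite dist_refl; lra |].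
      rewrite <- nsum_scal; apply nsum_le; intros j Hj.
      assert (w j = 0); [| nra].
      destruct (Hw j); [exfalso; eauto | auto]. }
  destruct (decaying_ball_finite (a j0) x r) as [b [Eb Hb]]; auto.
  { apply Ha; lra. }
  apply NNPP; intros Hno.
  pose (A := fun j => hyp_nbhd n (a j) (c j) eps).
  assert (HA : forall j, borel n (A j)).
  { intros j; apply borel_hyp_nbhd. }
  (* Restricting to the support costs no measure and ensures that the point found is a legal
     centre. *)
  pose (E := fun z => cball n x r z /\ supp n mu z).
  assert (BS : borel n (supp n mu)) by apply borel_closed, open_compl_supp.
  assert (BE : borel n E) by (apply borel_and; [apply borel_cball | exact BS]).
  assert (EE : mu E = EFin b).
  { destruct (measure_split n mu Hmu (supp n mu) (cball n x r) b BS (borel_cball n x r) Eb)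
      as [b1 [b2 [E1 [E2 [Hs [P1 P2]]]]]].
    destruct (measure_sub n mu Hmu (fun z => cball n x r z /\ ~ supp n mu z)
      (fun z => ~ supp n mu z) 0) as [b3 [E3 H3]].
    - apply borel_and, borel_compl, BS; apply borel_cball.
    - apply borel_compl, BS.
    - tauto.
    - apply measure_compl_supp, Hmu.
    - rewrite E2 in E3; injection E3 as <-; unfold E; rewrite E1; f_equal; lra. }
  pose proof (weighted_markov w A J HA E (kap * nsum w J) b BE EE) as HM.
  assert (HL : kap * nsum w J * b <= nsum (fun j => w j * mval (fun z => E z /\ A j z)) J).
  { apply HM; intros z [Hz Sz]; apply Rnot_lt_le; intros Hlt; apply Hno.
    exists z; split; [exact Sz |]; split; [exact Hz |].
    eapply Rle_trans; [| left; exact Hlt]; apply nsum_le; intros j _.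
    destruct (Req_dec (w j) 0) as [H0|H0]; [rewrite H0; lra |].
    apply Rmult_le_compat_l; [apply Hw | apply ind_le, hyp_nbhd_slab, Ha, H0]. }
  assert (HU : nsum (fun j => w j * mval (fun z => E z /\ A j z)) J
    < nsum (fun j => (kap * b) * w j) J); [| rewrite nsum_scal in HU; lra].
  assert (Hm : forall j, w j <> 0 -> mval (fun z => E z /\ A j z) < kap * b).
  { intros j Hj; unfold A.
    pose proof (Hdecay (a j) (c j) x r eps (Ha j Hj) Hx (proj1 Hr) (proj2 Hr) He) as Hd.
    assert (BN : borel n (fun z => cball n x r z /\ hyp_nbhd n (a j) (c j) eps z))
      by (apply borel_and; [apply borel_cball | apply borel_hyp_nbhd]).
    destruct (mu (fun z => cball n x r z /\ hyp_nbhd n (a j) (c j) eps z)) as [s|] eqn:Es;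
      rewrite Eb in Hd; simpl in Hd; [| tauto].
    destruct (measure_sub n mu Hmu (fun z => E z /\ hyp_nbhd n (a j) (c j) eps z)
      (fun z => cball n x r z /\ hyp_nbhd n (a j) (c j) eps z) s) as [s1 [Es1 Hs1]]; auto.
    - apply borel_and; [exact BE | apply borel_hyp_nbhd].
    - unfold E; tauto.
    - unfold mval; rewrite Es1; fold kap in Hd; lra. }
  apply nsum_lt.
  - intros j _; destruct (Req_dec (w j) 0) as [H0|H0]; [rewrite H0; lra |].
    specialize (Hm j H0); specialize (Hw j); nra.
  - exists j0; split; [exact Hj0 |]; specialize (Hm j0 ltac:(lra)); nra.
Qed.

End Decay.

(** * The game *)

(** The only property of [K] that the game uses. Moving the centre by at most [(1 - alpha) * rho]
    keeps Alice's ball inside Bob's. The slab half-width is twice Alice's radius, so that an escaped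
    hyperplane cannot threaten any later ball of Bob. *)
Definition half_avoiding n (K : Rn n -> Prop) (alpha rho0 : R) : Prop :=
  forall (a : nat -> Rn n) (c w : nat -> R) J x rho,
    K x -> 0 < rho < rho0 ->
    (forall j, 0 <= w j) -> (forall j, w j <> 0 -> exists i, a j i <> 0) ->
    exists z, K z /\ dist n x z <= (1 - alpha) * rho /\
      nsum (fun j => w j * ind (Rabs (dot n (a j) z - c j) <= 2 * alpha * rho * norm n (a j))) J
      <= / 2 * nsum w J.

Lemma decaying_half_avoiding n K :
  (exists mu : (Rn n -> Prop) -> ereal,
     is_measure n mu /\ absolutely_decaying n mu /\ forall x, K x <-> supp n mu x) ->
  exists alpha rho0, 0 < alpha < 1 /\ 0 < rho0 /\ half_avoiding n K alpha rho0.
Proof.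
  intros [mu [Hmu [[C [gamma [HC [Hg [rho0 [Hr0 Hd]]]]]] HK]]].
  (* [t] solves [C * t^gamma = 1/2]. With [alpha <= 1/2] and [alpha <= t/4], the ratio
     [2 alpha / (1 - alpha)] of width to radius is at most [t]. *)
  set (t := Rpower (/ (2 * C)) (/ gamma)).
  assert (Ht : 0 < t) by apply exp_pos.
  set (alpha := Rmin (/ 2) (t / 4)).
  assert (Ha : 0 < alpha) by (apply Rmin_glb_lt; lra).
  assert (Ha1 : alpha <= / 2) by apply Rmin_l.
  assert (Ha2 : alpha <= t / 4) by apply Rmin_r.
  exists alpha, rho0; split; [lra |]; split; [exact Hr0 |].
  intros a c w J x rho Kx Hr Hw Hna.
  destruct (avoid_hyperplanes n mu C gamma rho0 Hmu HC Hd a c w J x ((1 - alpha) * rho)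
    (2 * alpha * rho)) as [z [Hz1 [Hz2 Hz3]]]; auto; [apply HK, Kx | nra | nra |].
  exists z; split; [apply HK, Hz1 |]; split; [exact Hz2 |].
  eapply Rle_trans; [exact Hz3 |].
  apply Rmult_le_compat_r; [apply nsum_ge0; auto |].
  replace (2 * alpha * rho / ((1 - alpha) * rho)) with (2 * alpha / (1 - alpha)) by (field; lra).
  assert (H : Rpower (2 * alpha / (1 - alpha)) gamma <= Rpower t gamma).
  { apply Rle_Rpower_l; [lra |]; split; [apply Rdiv_lt_0_compat; lra |].
    apply Rmult_le_reg_r with (1 - alpha); [lra |].
    unfold Rdiv; rewrite Rmult_assoc, Rinv_l by lra; nra. }
  unfold t in H; rewrite Rpower_mult, Rinv_l, Rpower_1 in H by (try apply Rinv_0_lt_compat; lra).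
  apply Rle_trans with (C * / (2 * C)); [nra |]; right; field; lra.
Qed.

Lemma Rabs_le_bounds x a : Rabs x <= a -> - a <= x <= a.
Proof.
  pose proof (Rle_abs x); pose proof (Rle_abs (- x)); rewrite Rabs_Ropp in *; lra.
Qed.

Lemma Rpower_neg_le x y e : 0 < x <= y -> 0 <= e -> Rpower y (- e) <= Rpower x (- e).
Proof.
  intros H He; rewrite !Rpower_Ropp; apply Rinv_le_contravar; [apply exp_pos |].
  apply Rle_Rpower_l; lra.
Qed.

Lemma pow_unbounded q b : 1 < q -> exists N, b <= q ^ N.
Proof.
  intros Hq; destruct (Pow_x_infinity q) with (b := b) as [N HN].
  - rewrite Rabs_right; lra.
  - exists N; specialize (HN N (le_n _)); rewrite Rabs_right in HN; [lra |].
    apply Rle_ge, pow_le; lra.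
Qed.

Lemma pow_vanishing l e : 0 < l < 1 -> 0 < e -> exists N, l ^ N < e.
Proof.
  intros Hl He; destruct (pow_lt_1_zero l) with (y := e) as [N HN]; auto.
  - rewrite Rabs_right; lra.
  - exists N; specialize (HN N (le_n _)); rewrite Rabs_right in HN; [lra |].
    apply Rle_ge, pow_le; lra.
Qed.

Lemma least_nat (P : nat -> Prop) N : P N -> exists J, P J /\ forall j, (j < J)%nat -> ~ P j.
Proof.
  induction N as [N IH] using (well_founded_induction lt_wf); intros HP.
  destruct (classic (exists j, (j < N)%nat /\ P j)) as [[j [Hj Pj]]|Hn].
  - apply (IH j Hj Pj).
  - exists N; split; [exact HP |]; intros j Hj Pj; apply Hn; eauto.
Qed.

Lemma nsum_split f J T : nsum f (J + T) = nsum f J + nsum (fun i => f (J + i)%nat) T.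
Proof.
  induction T as [|T IH]; simpl; [rewrite Nat.add_0_r; lra |].
  rewrite Nat.add_succ_r; simpl; rewrite IH; lra.
Qed.

(** * The potential and Alice's strategy for one lacunary family *)

Section Game.
Variables (n : nat) (K : Rn n -> Prop) (alpha rho0 : R).
Hypotheses (Halpha : 0 < alpha < 1) (Hrho0 : 0 < rho0) (Havoid : half_avoiding n K alpha rho0).
(** The hyperplanes are [u j . x = c + m] with [m] an integer. The predicate [D] marks the levels
    that are really present, so that an enumeration may contain zero vectors or junk elsewhere. *)
Variables (u : nat -> Rn n) (D : nat -> Prop) (c q c1 C1 : R).
Hypotheses (Hq : 1 < q) (Hc1 : 0 < c1) (HC1 : 0 < C1).
Hypothesis (Hu : forall j, D j -> c1 * q ^ j <= norm n (u j) <= C1 * q ^ j).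
Variable (beta : R).
Hypothesis (Hbeta : 0 < beta < 1).

(** [lam] is the ratio of consecutive radii of Bob. *)
Let lam := beta * alpha.
Let eta := ln (3 / 2) / - ln lam.

Lemma lam_bounds : 0 < lam < 1.
Proof. unfold lam; nra. Qed.

Lemma eta_pos : 0 < eta.
Proof.
  pose proof lam_bounds; apply Rdiv_lt_0_compat.
  - rewrite <- ln_1; apply ln_increasing; lra.
  - pose proof (ln_increasing lam 1); rewrite ln_1 in *; lra.
Qed.

(** Consecutive hyperplanes of level [j] are about [q^(-j)] apart, so [q ^ j * rho] compares the
    radius with this gap. The weight is large when the ball is small compared with the gap. *)
Definition weight (j : nat) (rho : R) : R := Rpower (q ^ j * rho) (- eta).

Lemma qpow_pos j : 0 < q ^ j.
Proof. apply pow_lt; lra. Qed.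

(* This is the equation that determines [eta]. *)
Lemma weight_shrink j rho : 0 < rho -> weight j (lam * rho) = 3 / 2 * weight j rho.
Proof.
  intros Hr; pose proof lam_bounds; pose proof (qpow_pos j); unfold weight.
  replace (q ^ j * (lam * rho)) with (lam * (q ^ j * rho)) by ring.
  rewrite <- Rpower_mult_distr by (try apply Rmult_lt_0_compat; lra); f_equal.
  unfold Rpower, eta.
  pose proof (ln_increasing lam 1); rewrite ln_1 in *.
  replace (- (ln (3 / 2) / - ln lam) * ln lam) with (ln (3 / 2)) by (field; lra).
  apply exp_ln; lra.
Qed.

(** The factor [2] exceeds what the ball needs: when there is no danger, all points of the ball, and
    not only its centre, stay at distance at least [rho] from the hyperplanes. *)
Definition danger (j : nat) (x : Rn n) (rho : R) : Prop :=
  D j /\ exists m : Z, Rabs (dot n (u j) x - c - IZR m) <= 2 * norm n (u j) * rho.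

(** Positivity of [rho] stands inside the existential so that [level] becomes a total function by
    choice. *)
Lemma active_levels : forall rho, exists J, 0 < rho -> forall j, (j < J)%nat <-> 4 * C1 * q ^ j * rho < 1.
Proof.
  intros rho; destruct (Rlt_dec 0 rho) as [Hr|Hr]; [| exists 0%nat; intros; lra].
  assert (HCr : 0 < 4 * C1 * rho) by nra.
  destruct (pow_unbounded q (/ (4 * C1 * rho)) Hq) as [N HN].
  destruct (least_nat (fun j => 1 <= 4 * C1 * q ^ j * rho) N) as [J [HJ Hmin]].
  - apply Rmult_le_compat_l with (r := 4 * C1 * rho) in HN; [| lra].
    rewrite Rinv_r in HN; nra.
  - exists J; intros _ j; split; intros H.
    + apply Rnot_le_lt; auto.
    + destruct (Nat.lt_ge_cases j J) as [Hj|Hj]; [exact Hj | exfalso].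
      pose proof (Rle_pow q J j ltac:(lra) Hj); nra.
Qed.

Definition level (rho : R) : nat :=
  proj1_sig (constructive_indefinite_description _ (active_levels rho)).

Lemma level_spec rho : 0 < rho -> forall j, (j < level rho)%nat <-> 4 * C1 * q ^ j * rho < 1.
Proof. unfold level; destruct constructive_indefinite_description; auto. Qed.

Definition potential (x : Rn n) (rho : R) : R :=
  nsum (fun j => ind (danger j x rho) * weight j rho) (level rho).

Lemma danger_term_ge0 j x rho : 0 <= ind (danger j x rho) * weight j rho.
Proof. apply Rmult_le_pos; [apply ind_bounds | left; apply exp_pos]. Qed.

(** With [q ^ T >= 1 / lam], one round multiplies the inverse radius by at most [q ^ T], so at most
    [T] levels become active. *)
Lemma level_step : exists T, forall rho, 0 < rho ->
  exists T', (T' <= T)%nat /\ level (lam * rho) = (level rho + T')%nat.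
Proof.
  pose proof lam_bounds as Hl; destruct (pow_unbounded q (/ lam) Hq) as [T HT]; exists T.
  intros rho Hr; assert (Hlr : 0 < lam * rho) by nra.
  assert (H1 : (level rho <= level (lam * rho))%nat).
  { apply Nat.nlt_ge; intros H; apply level_spec in H; [| exact Hr].
    apply (Nat.lt_irrefl (level (lam * rho))), level_spec; [exact Hlr |].
    pose proof (qpow_pos (level (lam * rho))).
    assert (0 < 4 * C1 * q ^ level (lam * rho) * rho) by (repeat apply Rmult_lt_0_compat; lra).
    nra. }
  assert (H2 : (level (lam * rho) <= level rho + T)%nat).
  { apply Nat.nlt_ge; intros H; apply level_spec in H; [| exact Hlr].
    apply (Nat.lt_irrefl (level rho)), level_spec; [exact Hr |].
    rewrite pow_add in H.
    assert (1 <= q ^ T * lam).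
    { apply Rmult_le_compat_r with (r := lam) in HT; [| lra]; rewrite Rinv_l in HT; lra. }
    assert (0 < 4 * C1 * q ^ level rho * rho)
      by (pose proof (qpow_pos (level rho)); repeat apply Rmult_lt_0_compat; lra).
    nra. }
  exists (level (lam * rho) - level rho)%nat; lia.
Qed.

(** A hyperplane threatening Bob's next ball already threatened the present one, and Alice's centre
    failed to escape it. In units of [|u j| * rho] the triangle inequality gives
    [(alpha - lam) + 2 lam <= 2 alpha] at [x'], then [(1 - alpha) + (alpha + lam) <= 2] at [x]. *)
Lemma danger_parent j x x' x'' rho m : D j -> 0 < rho ->
  dist n x x' <= (1 - alpha) * rho -> lam * rho + dist n x' x'' <= alpha * rho ->
  Rabs (dot n (u j) x'' - c - IZR m) <= 2 * norm n (u j) * (lam * rho) ->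
  Rabs (dot n (u j) x' - c - IZR m) <= 2 * alpha * rho * norm n (u j) /\
  Rabs (dot n (u j) x - c - IZR m) <= 2 * norm n (u j) * rho.
Proof.
  intros Dj Hr Hxx' Hx'x'' Hm.
  pose proof (norm_ge0 n (u j)); pose proof lam_bounds; pose proof (dist_ge0 n x' x'').
  pose proof (dot_lipschitz n (u j) x' x'') as L1.
  pose proof (dot_lipschitz n (u j) x x') as L2.
  assert (A1 : norm n (u j) * dist n x' x'' <= norm n (u j) * ((alpha - lam) * rho))
    by (apply Rmult_le_compat_l; lra).
  assert (A2 : norm n (u j) * dist n x x' <= norm n (u j) * ((1 - alpha) * rho))
    by (apply Rmult_le_compat_l; lra).
  assert (lam <= alpha) by (unfold lam; nra).
  assert (A3 : norm n (u j) * rho * lam <= norm n (u j) * rho * alpha)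
    by (apply Rmult_le_compat_l; nra).
  assert (A4 : norm n (u j) * rho * alpha <= norm n (u j) * rho * 1)
    by (apply Rmult_le_compat_l; nra).
  apply Rabs_le_bounds in Hm; apply Rabs_le_bounds in L1; apply Rabs_le_bounds in L2.
  split; apply Rabs_le; lra.
Qed.

(** Below [level rho] both errors are less than [1/2], so the two integers differ by less than [1].
    Each active level thus poses at most one threat, to which a single weight can be attached. *)
Lemma danger_integer_unique j x rho (m m' : Z) : D j -> 0 < rho -> (j < level rho)%nat ->
  Rabs (dot n (u j) x - c - IZR m) <= 2 * norm n (u j) * rho ->
  Rabs (dot n (u j) x - c - IZR m') <= 2 * norm n (u j) * rho -> m = m'.
Proof.
  intros Dj Hr Hj H1 H2; apply level_spec in Hj; [| exact Hr].
  destruct (Hu j Dj) as [_ Hn].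
  assert (norm n (u j) * rho <= C1 * q ^ j * rho) by (apply Rmult_le_compat_r; lra).
  apply Rabs_le_bounds in H1; apply Rabs_le_bounds in H2.
  assert (G1 : IZR (m - m') < 1) by (rewrite minus_IZR; lra).
  assert (G2 : -1 < IZR (m - m')) by (rewrite minus_IZR; lra).
  apply lt_IZR in G1; apply lt_IZR in G2; lia.
Qed.

(** On old levels Alice halves the surviving weight and shrinking multiplies it by [3/2], whence
    [3/4]. The new levels are at most [T] in number and have bounded weight. *)
Lemma potential_step : exists N, 0 <= N /\ forall x rho, K x -> 0 < rho < rho0 ->
  exists x', K x' /\ dist n x x' <= (1 - alpha) * rho /\
    forall x'', lam * rho + dist n x' x'' <= alpha * rho ->
      potential x'' (lam * rho) <= 3 / 4 * potential x rho + N.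
Proof.
  destruct level_step as [T HT]; pose proof lam_bounds as Hl; pose proof eta_pos as He.
  (* A level not active at radius [rho] satisfies [4 C1 q^j rho >= 1], so in the next ball its
     weight is at most [W]. *)
  set (W := Rpower (lam / (4 * C1)) (- eta)).
  assert (HW : 0 < W) by apply exp_pos.
  exists (INR T * W); split; [pose proof (pos_INR T); nra |].
  intros x rho Kx Hr.
  assert (Hch : forall j, exists m : Z, danger j x rho ->
    Rabs (dot n (u j) x - c - IZR m) <= 2 * norm n (u j) * rho).
  { intros j; destruct (classic (danger j x rho)) as [[_ [m Hm]]|Hn];
      [exists m; auto | exists 0%Z; tauto]. }
  set (m := fun j => proj1_sig (constructive_indefinite_description _ (Hch j))).
  assert (Hm : forall j, danger j x rho ->
    Rabs (dot n (u j) x - c - IZR (m j)) <= 2 * norm n (u j) * rho).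
  { intros j; exact (proj2_sig (constructive_indefinite_description _ (Hch j))). }
  set (w := fun j => ind (danger j x rho) * weight j rho).
  destruct (Havoid u (fun j => c + IZR (m j)) w (level rho) x rho Kx Hr)
    as [x' [Kx' [Hx' Hsum]]].
  { intros j; apply danger_term_ge0. }
  { intros j Hj; apply NNPP; intros Hz.
    assert (Dj : danger j x rho)
      by (apply NNPP; intros Hn; apply Hj; unfold w; rewrite ind_false by exact Hn; ring).
    destruct Dj as [Dj _]; destruct (Hu j Dj) as [Hn _].
    pose proof (qpow_pos j).
    assert (norm n (u j) = 0); [| nra].
    transitivity (norm n (fun i => 0 * u j i)); [| rewrite norm_scal, Rabs_R0; ring].
    f_equal; extensionality i; apply NNPP; intros Hi; apply Hz; exists i; lra. }
  exists x'; split; [exact Kx' |]; split; [exact Hx' |].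
  intros x'' Hx''; unfold potential.
  destruct (HT rho (proj1 Hr)) as [T' [HT' ->]]; rewrite nsum_split.
  apply Rplus_le_compat.
  - fold w; apply Rle_trans with (3 / 2 * (/ 2 * nsum w (level rho))); [| lra].
    eapply Rle_trans; [| apply Rmult_le_compat_l; [lra | exact Hsum]].
    rewrite <- nsum_scal; apply nsum_le; intros j Hj.
    rewrite weight_shrink by lra.
    destruct (classic (danger j x'' (lam * rho))) as [[Dj [m' Hm']]|Hn].
    + destruct (danger_parent j x x' x'' rho m' Dj (proj1 Hr) Hx' Hx'' Hm') as [P1 P2].
      assert (Hd : danger j x rho) by (split; eauto).
      (* Uniqueness identifies the surviving threat with the hyperplane chosen before Alice's
         move. *)
      assert (m' = m j) as -> by (apply (danger_integer_unique j x rho); auto; lra).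
      unfold w; rewrite !ind_true; [lra | | exact Hd | split; eauto].
      rewrite Rminus_plus_distr; exact P1.
    + rewrite ind_false by exact Hn.
      assert (0 <= w j * ind (Rabs (dot n (u j) x' - (c + IZR (m j))) <=
        2 * alpha * rho * norm n (u j)))
        by (apply Rmult_le_pos; [apply danger_term_ge0 | apply ind_bounds]).
      lra.
  - apply Rle_trans with (nsum (fun _ => W) T').
    + apply nsum_le; intros i _.
      set (j := (level rho + i)%nat).
      assert (Hj : 1 <= 4 * C1 * q ^ j * rho).
      { apply Rnot_lt_le; intros H; apply level_spec in H; [unfold j in H; lia | lra]. }
      assert (Hwt : weight j (lam * rho) <= W).
      { apply Rpower_neg_le; [| lra]; split; [apply Rdiv_lt_0_compat; lra |].
        apply Rmult_le_reg_r with (4 * C1); [lra |].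
        unfold Rdiv; rewrite Rmult_assoc, Rinv_l by lra; nra. }
      pose proof (ind_bounds (danger j x'' (lam * rho))).
      assert (0 < weight j (lam * rho)) by apply exp_pos.
      nra.
    + rewrite nsum_const; apply Rmult_le_compat_r; [lra | apply le_INR, HT'].
Qed.

Lemma game_winning (S : Rn n -> Prop) :
  (forall z, (exists delta, 0 < delta /\ forall j, D j -> forall m : Z,
                delta <= Rabs (dot n (u j) z - c - IZR m)) -> S z) ->
  ab_winning n K S alpha beta.
Proof.
  intros HS; destruct potential_step as [N [HN Hstep]]; pose proof lam_bounds as Hl.
  assert (Hmove : forall w : Rn n * R, exists x', K (fst w) -> 0 < snd w ->
    K x' /\ leS n (x', alpha * snd w) w /\
    (snd w < rho0 -> forall x'', lam * snd w + dist n x' x'' <= alpha * snd w ->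
       potential x'' (lam * snd w) <= 3 / 4 * potential (fst w) (snd w) + N)).
  { intros [x rho]; simpl; unfold leS; simpl.
    destruct (classic (K x /\ 0 < rho < rho0)) as [[Kx Hr]|Hn].
    - destruct (Hstep x rho Kx Hr) as [x' [H1 [H2 H3]]]; exists x'; intros _ _.
      split; [exact H1 |]; split; [lra | auto].
    (* While the ball is too large for the decay condition, Alice waits at Bob's centre. *)
    - exists x; intros Kx Hr; split; [exact Kx |]; split; [rewrite dist_refl; nra | tauto]. }
  set (next := fun w => proj1_sig (constructive_indefinite_description _ (Hmove w))).
  assert (Hnext : forall w, K (fst w) -> 0 < snd w ->
    K (next w) /\ leS n (next w, alpha * snd w) w /\
    (snd w < rho0 -> forall x'', lam * snd w + dist n (next w) x'' <= alpha * snd w ->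
       potential x'' (lam * snd w) <= 3 / 4 * potential (fst w) (snd w) + N))
    by (intros w; exact (proj2_sig (constructive_indefinite_description _ (Hmove w)))).
  clearbody next.
  (* The strategy looks only at Bob's last move. The default of [last] is never reached, since the
     histories in [alice_center] are nonempty. *)
  pose (sigma := (fun h => next (last h ((fun _ => 0), 0))) : strategy n).
  assert (Hsig : forall b k, alice_center n sigma b k = next (b k)).
  { intros b k; unfold alice_center, sigma; rewrite seq_S, map_app; simpl.
    rewrite last_last; reflexivity. }
  assert (Hinv : forall b k, bob_start n K b ->
    (forall j, (j < k)%nat -> bob_step_ok n K alpha beta sigma b j) ->
    K (fst (b k)) /\ 0 < snd (b k)).
  { intros b k [H1 H2]; induction k as [|k IH]; intros Hb; [auto |].
    destruct IH as [I1 I2]; [auto |].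
    destruct (Hb k) as [B1 [B2 _]]; [lia |].
    split; [exact B1 |]; rewrite B2; repeat apply Rmult_lt_0_compat; lra. }
  exists sigma; split.
  - intros b k Hs Hb; destruct (Hinv b k Hs Hb) as [I1 I2].
    unfold alice_ok; rewrite Hsig; destruct (Hnext (b k) I1 I2) as [A1 [A2 _]]; auto.
  - intros b Hs Hb z Hz; split; [| apply (Hz 0%nat)].
    assert (HI : forall k, K (fst (b k)) /\ 0 < snd (b k)) by (intros; apply Hinv; auto).
    assert (Hrad : forall k, snd (b (Datatypes.S k)) = lam * snd (b k)).
    { intros k; destruct (Hb k) as [_ [E _]]; rewrite E; unfold lam; ring. }
    assert (Hpow : forall k, snd (b k) = lam ^ k * snd (b 0%nat)).
    { induction k as [|k IH]; [simpl; ring |]; rewrite Hrad, IH; simpl; ring. }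
    destruct (HI 0%nat) as [_ Hr0].
    assert (Hsmall : forall e, 0 < e -> exists k, snd (b k) < e).
    { intros e He; destruct (pow_vanishing lam (e / snd (b 0%nat)) Hl) as [k Hk].
      - apply Rdiv_lt_0_compat; lra.
      - exists k; rewrite Hpow; apply Rmult_lt_compat_r with (r := snd (b 0%nat)) in Hk; [| lra].
        unfold Rdiv in Hk; rewrite Rmult_assoc, Rinv_l in Hk; lra. }
    destruct (Hsmall rho0 Hrho0) as [t0 Ht0].
    (* The bound [B >= 4 N] is preserved by [P -> 3/4 P + N], from the first small ball onwards. *)
    set (B := potential (fst (b t0)) (snd (b t0)) + 4 * N).
    assert (HP0 : 0 <= potential (fst (b t0)) (snd (b t0)))
      by (apply nsum_ge0; intros; apply danger_term_ge0).
    assert (HB : forall i, snd (b (t0 + i)%nat) < rho0 /\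
      potential (fst (b (t0 + i)%nat)) (snd (b (t0 + i)%nat)) <= B).
    { induction i as [|i [I1 I2]]; [rewrite Nat.add_0_r; unfold B; lra |].
      rewrite Nat.add_succ_r; destruct (HI (t0 + i)%nat) as [J1 J2].
      rewrite Hrad; split; [nra |].
      destruct (Hnext (b (t0 + i)%nat) J1 J2) as [_ [_ A3]].
      destruct (Hb (t0 + i)%nat) as [_ [_ B3]]; unfold leS in B3; simpl in B3.
      rewrite Hsig, Hrad in B3; specialize (A3 I1 _ B3); unfold B in *; lra. }
    pose proof eta_pos as Heta.
    set (r0 := snd (b t0)) in *.
    assert (Hr0' : 0 < r0) by apply HI.
    set (kap0 := Rpower (B + 1) (- / eta)).
    assert (Hkap0 : 0 < kap0) by apply exp_pos.
    (* Three requirements: [kap0] makes a single weight exceed [B]; [r0 / 2] prevents the threshold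
       from being crossed already at time [t0]; [/ (8 * C1)] makes level [j] active once it is
       crossed. *)
    set (kap := Rmin kap0 (Rmin (r0 / 2) (/ (8 * C1)))).
    assert (H8 : 0 < / (8 * C1)) by (apply Rinv_0_lt_compat; lra).
    assert (Hkap : 0 < kap) by (repeat apply Rmin_glb_lt; lra).
    assert (K1 : kap <= kap0) by apply Rmin_l.
    assert (K2 : kap <= r0 / 2) by (eapply Rle_trans; [apply Rmin_r | apply Rmin_l]).
    assert (K3 : kap <= / (8 * C1)) by (eapply Rle_trans; [apply Rmin_r | apply Rmin_r]).
    assert (K3' : 8 * C1 * kap <= 1).
    { apply Rmult_le_compat_l with (r := 8 * C1) in K3; [| lra]; rewrite Rinv_r in K3; lra. }
    assert (KB : B < Rpower kap (- eta)).
    { apply Rlt_le_trans with (B + 1); [lra |].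
      apply Rle_trans with (Rpower kap0 (- eta)); [| apply Rpower_neg_le; lra].
      unfold kap0; rewrite Rpower_mult.
      replace (- / eta * - eta) with 1 by (field; lra).
      rewrite Rpower_1; unfold B; lra. }
    apply HS; exists (c1 * (lam * kap)); split; [repeat apply Rmult_lt_0_compat; lra |].
    intros j Dj m; pose proof (qpow_pos j) as Hqj.
    assert (Hq1 : 1 <= q ^ j) by (apply pow_R1_Rle; lra).
    destruct (Hsmall (kap / q ^ j)) as [k Hk]; [apply Rdiv_lt_0_compat; lra |].
    assert (Hk' : q ^ j * snd (b (t0 + k)%nat) < kap).
    { assert (snd (b (t0 + k)%nat) <= snd (b k)).
      { rewrite (Hpow (t0 + k)%nat), (Hpow k), pow_add.
        assert (lam ^ t0 <= 1) by (rewrite <- (pow1 t0); apply pow_incr; lra).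
        assert (0 < lam ^ k * snd (b 0%nat)) by (apply Rmult_lt_0_compat; [apply pow_lt |]; lra).
        nra. }
      apply Rmult_lt_compat_l with (r := q ^ j) in Hk; [| lra].
      replace (q ^ j * (kap / q ^ j)) with kap in Hk by (field; lra); nra. }
    (* At the first crossing time, minimality also bounds [q^j rho] below by [lam * kap], which
       makes the final gap independent of [j]. *)
    destruct (least_nat (fun k => q ^ j * snd (b (t0 + k)%nat) < kap) k Hk') as [t [Ht Hmin]].
    destruct t as [|t].
    { exfalso; rewrite Nat.add_0_r in Ht; fold r0 in Ht; nra. }
    assert (Hlow : lam * kap <= q ^ j * snd (b (t0 + Datatypes.S t)%nat)).
    { specialize (Hmin t ltac:(lia)); rewrite Nat.add_succ_r, Hrad; nra. }
    set (k0 := (t0 + Datatypes.S t)%nat) in *.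
    destruct (HI k0) as [_ Hrk].
    (* A danger at this moment would by itself push the potential above [B]. *)
    assert (Hnd : ~ danger j (fst (b k0)) (snd (b k0))).
    { intros Hd; destruct (HB (Datatypes.S t)) as [_ HBt]; fold k0 in HBt.
      assert (Hlev : (j < level (snd (b k0)))%nat) by (apply level_spec; [exact Hrk | nra]).
      pose proof (nsum_term_le (fun j => ind (danger j (fst (b k0)) (snd (b k0))) * weight j (snd (b k0)))
        (level (snd (b k0))) j (fun i _ => danger_term_ge0 i _ _) Hlev) as Hterm.
      simpl in Hterm; rewrite (ind_true _ Hd) in Hterm; unfold potential in HBt.
      assert (Rpower kap (- eta) <= weight j (snd (b k0))); [| lra].
      apply Rpower_neg_le; [split; [apply Rmult_lt_0_compat |]; lra | lra]. }
    assert (Hfar : 2 * norm n (u j) * snd (b k0) < Rabs (dot n (u j) (fst (b k0)) - c - IZR m)).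
    { apply Rnot_le_lt; intros H; apply Hnd; split; eauto. }
    destruct (Hz k0) as [_ Hzk].
    pose proof (dot_lipschitz n (u j) (fst (b k0)) z) as HL.
    destruct (Hu j Dj) as [Hu1 _].
    pose proof (norm_ge0 n (u j)).
    assert (HL2 : norm n (u j) * dist n (fst (b k0)) z <= norm n (u j) * snd (b k0))
      by (apply Rmult_le_compat_l; lra).
    assert (HL3 : c1 * (lam * kap) <= norm n (u j) * snd (b k0)) by nra.
    pose proof (Rabs_triang (dot n (u j) (fst (b k0)) - dot n (u j) z)
      (dot n (u j) z - c - IZR m)) as Htri.
    replace (dot n (u j) (fst (b k0)) - dot n (u j) z + (dot n (u j) z - c - IZR m))
      with (dot n (u j) (fst (b k0)) - c - IZR m) in Htri by ring.
    lra.
Qed.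

End Game.

(** * Growth of integer orbits *)

Module Orbit.
Import all_boot all_order all_algebra all_field complex boolp Rstruct.
Set Implicit Arguments. Unset Strict Implicit. Unset Printing Implicit Defensive.
Import Order.TTheory GRing.Theory Num.Theory.
Local Open Scope ring_scope.

(** Stated over any [numDomainType], so that it serves over the reals and over [R[i]], where moduli
    are themselves complex numbers. *)
Definition norm1 (F : numDomainType) n (v : 'rV[F]_n) : F := \sum_j `|v 0 j|.

Lemma norm1_ge0 (F : numDomainType) n (v : 'rV[F]_n) : 0 <= norm1 v.
Proof. exact: sumr_ge0. Qed.

Lemma norm1_gt0 (F : numDomainType) n (v : 'rV[F]_n) : v != 0 -> 0 < norm1 v.
Proof.
case/rV0Pn=> j nzj; rewrite /norm1 (bigD1 j) //=.
by rewrite ltr_pwDl ?normr_gt0 ?sumr_ge0.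
Qed.

Lemma norm1_sum (F : numDomainType) n (I : Type) (s : seq I) (f : I -> 'rV[F]_n) :
  norm1 (\sum_(i <- s) f i) <= \sum_(i <- s) norm1 (f i).
Proof.
rewrite /norm1 exchange_big /=; apply: ler_sum => j _.
by rewrite summxE ler_norm_sum.
Qed.

Lemma norm1Z (F : numDomainType) n (c : F) (v : 'rV[F]_n) :
  norm1 (c *: v) = `|c| * norm1 v.
Proof. by rewrite /norm1 mulr_sumr; apply: eq_bigr => j _; rewrite mxE normrM. Qed.

Lemma norm1_mul (F : numDomainType) n (T : 'M[F]_n) (v : 'rV[F]_n) :
  norm1 (v *m T) <= (\sum_j \sum_i `|T i j|) * norm1 v.
Proof.
rewrite /norm1 mulr_suml; apply: ler_sum => j _; rewrite mxE.
apply: le_trans (ler_norm_sum _ _ _) _; rewrite mulr_suml.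
apply: ler_sum => i _; rewrite normrM mulrC ler_wpM2l //.
by rewrite (bigD1 i) //= lerDl sumr_ge0.
Qed.

(** * Eigenvector decompositions and growth *)

Section Eigen.
Variables (F : numClosedFieldType) (n : nat) (A : 'M[F]_n.+1).

Lemma eigen_pow (u : 'rV[F]_n.+1) z k : u *m A = z *: u -> u *m A ^+ k = z ^+ k *: u.
Proof.
move=> uA; elim: k => [|k IHk]; first by rewrite !expr0 mulmx1 scale1r.
by rewrite !exprS -mulmxE mulmxA uA -scalemxAl IHk scalerA.
Qed.

Lemma eigen_prod (u : 'rV[F]_n.+1) z (s : seq F) (P : pred F) :
  u *m A = z *: u ->
  u *m \prod_(w <- s | P w) (A - w%:M) = (\prod_(w <- s | P w) (z - w)) *: u.
Proof.
move=> uA; elim: s => [|w s IHs]; first by rewrite !big_nil mulmx1 scale1r.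
rewrite !big_cons; case: ifP => // _.
by rewrite -mulmxE mulmxA mulmxBr uA mul_mx_scalar -scalerBl -scalemxAl IHs scalerA.
Qed.

(** By induction [a (A - t)] is a sum of eigenvectors [u z] with [z != t]. Dividing them by [z - t]
    gives vectors [v z] whose sum has the same image under [A - t] as [a], so the remainder [v0] is
    an eigenvector for [t]. *)
Lemma eigen_decomposition (s : seq F) (a : 'rV[F]_n.+1) :
  uniq s -> a *m \prod_(z <- s) (A - z%:M) = 0 ->
  exists2 u : F -> 'rV[F]_n.+1,
    {in s, forall z, u z *m A = z *: u z} & a = \sum_(z <- s) u z.
Proof.
elim: s a => [|t s IHs] a /=.
  by rewrite !big_nil mulmx1 => _ ->; exists (fun=> 0) => //; rewrite big_nil.
case/andP=> nts us; rewrite big_cons -mulmxE mulmxA => /(IHs _ us)[u uP ua].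
pose v z := (z - t)^-1 *: u z.
have vP z : z \in s -> v z *m A = z *: v z.
  by move=> zs; rewrite -scalemxAl uP // !scalerA mulrC.
pose v0 := a - \sum_(z <- s) v z.
have st z : z \in s -> z != t by apply: contraTneq => ->.
exists (fun z => if z == t then v0 else v z).
  move=> w; rewrite inE; case: eqP => [-> _|_ /= /vP //].
  apply/eqP; rewrite -mul_mx_scalar -subr_eq0 -mulmxBr mulmxBl ua subr_eq0.
  rewrite mulmx_suml; apply/eqP/eq_big_seq => z zs.
  rewrite mulmxBr vP // mul_mx_scalar -scalerBl scalerA mulfV ?scale1r //.
  by rewrite subr_eq0 st.
rewrite big_cons eqxx; under eq_big_seq => z zs do rewrite (negPf (st _ zs)).
by rewrite subrK.
Qed.

Lemma seq_max_norm (s : seq F) : s != [::] ->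
  exists2 t, t \in s & {in s, forall z, `|z| <= `|t|}.
Proof.
elim: s => // z [|w s] IHs _.
  by exists z; rewrite ?mem_head // => y; rewrite inE => /eqP->.
have [//|t ts tP] := IHs; have [zt|tz] := real_leP (normr_real z) (normr_real t).
  exists t => [|y]; first by rewrite inE ts orbT.
  by rewrite inE => /orP[/eqP->|/tP].
exists z => [|y]; first exact: mem_head.
by rewrite inE => /orP[/eqP->|/tP/le_trans->//]; rewrite // ltW.
Qed.

(** The upper bound is the triangle inequality. For the lower bound, [T] kills all components except
    that of an eigenvalue [t] of largest modulus, and a fixed matrix increases norms by at most a
    constant factor. *)
Lemma orbit_growth (s : seq F) (a : 'rV[F]_n.+1) :
  uniq s -> a != 0 -> a *m \prod_(z <- s) (A - z%:M) = 0 ->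
  exists q c d : F, [/\ 0 <= q, 0 < c, 0 < d &
    forall k, c * q ^+ k <= norm1 (a *m A ^+ k) <= d * q ^+ k].
Proof.
move=> us nza /(eigen_decomposition us)[u uP aE].
(* Vanishing components are dropped, so that the largest modulus belongs to an eigenvalue that
   really occurs in [a]. *)
pose s' := [seq z <- s | u z != 0].
have us' : uniq s' by rewrite filter_uniq.
have aE' : a = \sum_(z <- s') u z.
  rewrite aE big_filter (bigID (fun z => u z != 0)) /=.
  by rewrite [X in _ + X]big1 ?addr0 // => z; rewrite negbK => /eqP.
have uP' z : z \in s' -> u z *m A = z *: u z.
  by rewrite mem_filter => /andP[_ /uP].
have nz' : s' != [::].
  by apply: contra_neq nza => s0; rewrite aE' s0 big_nil.
have [t ts tP] := seq_max_norm nz'.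
have nzt : u t != 0 by move: ts; rewrite mem_filter => /andP[].
have akE k : a *m A ^+ k = \sum_(z <- s') z ^+ k *: u z.
  by rewrite aE' mulmx_suml; apply: eq_big_seq => z /uP'/eigen_pow.
pose T := \prod_(z <- s' | z != t) (A - z%:M).
pose m := \prod_(z <- s' | z != t) (t - z).
have nzm : m != 0.
  rewrite prodf_seq_neq0; apply/allP => z zs; apply/implyP => zt.
  by rewrite subr_eq0 eq_sym.
have akT k : a *m A ^+ k *m T = (t ^+ k * m) *: u t.
  have uT z : z \in s' -> u z *m T = (\prod_(w <- s' | w != t) (z - w)) *: u z.
    by move/uP'; apply: eigen_prod.
  rewrite akE mulmx_suml (bigD1_seq t) //= -scalemxAl uT // scalerA.
  rewrite [X in _ + X]big1_seq ?addr0 // => z /andP[zt zs].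
  rewrite -scalemxAl uT // (big_rem z) //= zt subrr mul0r scale0r scaler0 //.
pose B := \sum_j \sum_i `|T i j| + 1.
have B0 : 0 < B by rewrite ltr_wpDl // sumr_ge0 // => j _; rewrite sumr_ge0.
exists `|t|, (`|m| * norm1 (u t) / B), (\sum_(z <- s') norm1 (u z)).
split=> [|||k] //.
- by rewrite divr_gt0 // mulr_gt0 ?normr_gt0 ?norm1_gt0.
- rewrite (bigD1_seq t) //= ltr_pwDl ?norm1_gt0 //.
  by apply: sumr_ge0 => z _; apply: norm1_ge0.
apply/andP; split.
  have -> : `|m| * norm1 (u t) / B * `|t| ^+ k = norm1 (a *m A ^+ k *m T) / B.
    by rewrite akT norm1Z normrM normrX mulrC !mulrA.
  rewrite ler_pdivrMr // mulrC; apply: le_trans (norm1_mul _ _) _.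
  by rewrite ler_wpM2r ?norm1_ge0 // lerDl.
rewrite akE mulr_suml; apply: le_trans (norm1_sum _ _) _.
rewrite !big_seq; apply: ler_sum => z zs; rewrite norm1Z normrX mulrC.
by rewrite ler_wpM2l ?norm1_ge0 // lerXn2r ?nnegrE ?tP.
Qed.
End Eigen.

(** Let [p] be the minimal polynomial and [g = gcd(p, p')]. Then [p / g] is separable, and [g(A)] is
    nonzero because [g] has smaller degree than [p]. Every row of [g(A)] is annihilated by
    [(p / g)(A)], as the product is [p(A) = 0]. *)
Lemma separable_row_annihilator n (A : 'M[int]_n.+1) :
  exists (a : 'rV[int]_n.+1) (q : {poly rat}), [/\ a != 0, separable_poly q &
    map_mx intr a *m horner_mx (map_mx intr A) q = 0].
Proof.
pose Aq : 'M[rat]_n.+1 := map_mx intr A.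
pose p := mxminpoly Aq; pose g := gcdp p p^`().
have nzp : p != 0 by apply: monic_neq0; apply: mxminpoly_monic.
have gA : horner_mx Aq g != 0.
  apply/eqP => /mxminpoly_min pg.
  have nzp' : p^`() != 0.
    rewrite -size_poly_eq0 polyorder.size_deriv -lt0n -ltnS prednK ?size_poly_gt0 //.
    by rewrite size_mxminpoly ltnS mxminpoly_nonconstant.
  have := dvdp_leq nzp' (dvdp_trans pg (dvdp_gcdr _ _)).
  by rewrite leqNgt lt_size_deriv.
(* Clearing denominators in [g] makes the row integral without changing its annihilators. *)
have [gi [d nzd gE]] := rat_poly_scale g.
have giA : map_mx intr (horner_mx A gi) = d%:~R *: horner_mx Aq g.
  rewrite map_horner_mx gE linearZ /= scalerA mulfV ?intr_eq0 //.
  by rewrite scale1r.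
have /matrix0Pn[i [j nz]] : horner_mx A gi != 0.
  apply: contra_neq gA => g0; move/eqP: giA; rewrite g0 map_mx0 eq_sym scaler_eq0.
  by rewrite intr_eq0 (negPf nzd) /= => /eqP.
exists (row i (horner_mx A gi)), (p %/ g); split.
- by apply/rV0Pn; exists j; rewrite mxE.
- exact: make_separable.
rewrite map_row giA linearZ /= -scalemxAl -row_mul mulmxE -rmorphM /=.
by rewrite mulrC divpK ?dvdp_gcdl // mx_root_minpoly row0 scaler0.
Qed.

Lemma int_orbit_growth (R : rcfType) n (A : 'M[int]_n.+1) :
  exists (a : 'rV[int]_n.+1) (q c d : R), [/\ a != 0, 0 <= q, 0 < c, 0 < d &
    forall k, c * q ^+ k <= norm1 (map_mx intr (a *m A ^+ k)) <= d * q ^+ k].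
Proof.
have [a [p [nza sep pa]]] := separable_row_annihilator A.
pose C : numClosedFieldType := R[i].
pose Ac : 'M[C]_n.+1 := map_mx intr A.
pose ac : 'rV[C]_n.+1 := map_mx intr a.
have [s pE] := closed_field_poly_normal (map_poly (ratr : rat -> C) p).
have nzp : p != 0 := separable_poly_neq0 sep.
(* Separability says that the complex roots are distinct, as the eigenvector decomposition
   requires. *)
have us : uniq s.
  move: sep; rewrite -(separable_map (ratr : {rmorphism rat -> C})) pE.
  rewrite -separable_prod_XsubC; apply: dvdp_separable.
  by rewrite dvdpZr ?dvdpp // lead_coef_eq0 map_poly_eq0.
have ratrA m1 m2 (B : 'M[int]_(m1, m2)) : map_mx (ratr : rat -> C) (map_mx intr B) = map_mx intr B.
  by apply/matrixP => i j; rewrite !mxE ratr_int.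
have pac : ac *m \prod_(z <- s) (Ac - z%:M) = 0.
  have := congr1 (map_mx (ratr : rat -> C)) pa.
  rewrite map_mxM map_horner_mx !ratrA map_mx0 pE linearZ /= rmorph_prod /=.
  under eq_bigr => z _ do rewrite rmorphB /= horner_mx_X horner_mx_C.
  move/eqP; rewrite -scalemxAr scaler_eq0 lead_coef_eq0 map_poly_eq0 (negPf nzp).
  by move=> /eqP.
have nzac : ac != 0.
  case/rV0Pn: nza => j nz; apply/rV0Pn; exists j; by rewrite mxE intr_eq0.
have [q [c [d [q0 c0 d0 H]]]] := orbit_growth us nzac pac.
(* The growth constants are nonnegative elements of [R[i]], hence real, so the inequalities descend
   to [R]. *)
have reE (x : C) : 0 <= x -> x = (complex.Re x)%:C%C by move/ger0_real/RRe_real.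
have qE := reE q q0; have cE := reE c (ltW c0); have dE := reE d (ltW d0).
exists a, (complex.Re q), (complex.Re c), (complex.Re d).
rewrite -lecR -qE -!ltcR -cE -dE; split => // k.
have nE : (norm1 (map_mx intr (a *m A ^+ k)) : R)%:C%C = norm1 (ac *m Ac ^+ k).
  have -> : Ac ^+ k = map_mx intr (A ^+ k) by rewrite rmorphXn.
  rewrite -map_mxM /norm1 rmorph_sum /=; apply: eq_bigr => j _; rewrite !mxE.
  by rewrite -!intr_norm rmorph_int.
by have := H k; rewrite -nE cE dE qE -!rmorphXn -!rmorphM /= !lecR.
Qed.

(** * Translation between the two encodings of integers, indices and vectors *)

Lemma IZR_intr (z : Z) : exists i : int, IZR z = i%:~R.
Proof.
case: z => [|p|p]; first by exists 0.
  by exists (Posz (nat_of_pos p)); rewrite IZRposE INRE.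
exists (- Posz (nat_of_pos p)); rewrite rmorphN /=.
have -> : (Posz (nat_of_pos p))%:~R = IZR (Z.pos p) by rewrite IZRposE INRE.
by [].
Qed.

Lemma intr_IZR (i : int) : exists z : Z, i%:~R = IZR z.
Proof.
case: i => k; first by exists (Z.of_nat k); rewrite -INR_IZR_INZ INRE.
exists (Z.opp (Z.of_nat k.+1)); rewrite opp_IZR -INR_IZR_INZ NegzE rmorphN /=.
by have -> : (Posz k.+1)%:~R = INR k.+1 by rewrite INRE.
Qed.

Definition fin_of_ord (n : nat) (i : 'I_n) : Fin.t n :=
  Fin.of_nat_lt (elimT ssrnat.ltP (ltn_ord i)).

Definition ord_of_fin (n : nat) (i : Fin.t n) : 'I_n :=
  Ordinal (introT ssrnat.ltP (proj2_sig (Fin.to_nat i))).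

Lemma ord_of_finK (n : nat) : cancel (@ord_of_fin n) (@fin_of_ord n).
Proof.
move=> i; apply: Fin.to_nat_inj; rewrite /fin_of_ord Fin.to_nat_of_nat //=.
Qed.

Lemma fin_of_ordK (n : nat) : cancel (@fin_of_ord n) (@ord_of_fin n).
Proof.
by move=> i; apply: val_inj; rewrite /= /fin_of_ord Fin.to_nat_of_nat.
Qed.

Lemma fsumE (n : nat) (f : Fin.t n -> R) : fsum n f = \sum_(i < n) f (fin_of_ord i).
Proof.
elim: n f => [|n IHn] f; first by rewrite big_ord0.
rewrite big_ord_recl /= IHn RplusE; congr (f _ + _); apply: eq_bigr => i _; congr f.
by apply: Fin.to_nat_inj; rewrite /fin_of_ord /= !Fin.to_nat_of_nat.
Qed.

Lemma integer_orbit_growth (m : nat) (M : Mat m.+1) : integer_matrix m.+1 M ->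
  exists (a : Rn m.+1) (q c d : R),
    (forall i, exists z : Z, a i = IZR z) /\ (exists i, a i <> 0) /\
    Rle 0 q /\ Rlt 0 c /\ Rlt 0 d /\
    forall k : nat,
      let s := fsum m.+1 (fun i => Rabs (Nat.iter k (mvec m.+1 (fun i j => M j i)) a i)) in
      Rle (Rmult c (pow q k)) s /\ Rle s (Rmult d (pow q k)).
Proof.
move=> MZ.
have [f fP] : {f : Fin.t m.+1 -> Fin.t m.+1 -> int & forall i j, M i j = (f i j)%:~R}.
  have H i j : {z : int | M i j = z%:~R}.
    by apply: cid; have [z ->] := MZ i j; apply: IZR_intr.
  by exists (fun i j => sval (H i j)) => i j; exact: (svalP (H i j)).
pose A := \matrix_(i, j) f (fin_of_ord i) (fin_of_ord j).
have [a [q [c [d [nza q0 c0 d0 H]]]]] := int_orbit_growth Rdefinitions.R A.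
pose b : Rn m.+1 := fun i => (a 0 (ord_of_fin i))%:~R.
(* Iterating the transpose on columns is multiplying a row by powers of [A] on the right. *)
have bE k i : Nat.iter k (mvec m.+1 (fun i j => M j i)) b i
    = ((a *m A ^+ k) 0 (ord_of_fin i))%:~R.
  elim: k i => [|k IHk] i; first by rewrite expr0 mulmx1.
  rewrite exprSr -mulmxE mulmxA mxE rmorph_sum /= /mvec fsumE.
  apply: eq_bigr => j _; rewrite -/(mvec _ _) IHk fin_of_ordK RmultE fP mulrC rmorphM /=.
  by rewrite [A j _]mxE ord_of_finK.
exists b, q, c, d; split; first by move=> i; apply: intr_IZR.
split.
  have /rV0Pn[j nzj] := nza; exists (fin_of_ord j); rewrite /b fin_of_ordK.
  by apply/eqP; rewrite intr_eq0.
split; first exact/RleP. split; first exact/RltP. split; first exact/RltP.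
move=> k s; have /andP[H1 H2] := H k.
suff -> : s = norm1 (map_mx intr (a *m A ^+ k)).
  by rewrite !RpowE; split; apply/RleP.
rewrite /s fsumE /norm1; apply: eq_bigr => i _.
by rewrite bE RabsE fin_of_ordK [in RHS]mxE.
Qed.

End Orbit.

(** * Toral endomorphisms *)

Definition integer_vec n (v : Rn n) : Prop := forall i, exists z : Z, v i = IZR z.

Lemma fsum_integer n f : integer_vec n f -> exists z : Z, fsum n f = IZR z.
Proof.
  induction n as [|n IH]; intros H; simpl; [exists 0%Z; reflexivity |].
  destruct (H Fin.F1) as [z Hz]; destruct (IH (fun i => f (Fin.FS i)) (fun i => H _)) as [z' Hz'].
  exists (z + z')%Z; rewrite Hz, Hz', plus_IZR; reflexivity.
Qed.

Lemma dot_integer n a b : integer_vec n a -> integer_vec n b -> exists z : Z, dot n a b = IZR z.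
Proof.
  intros Ha Hb; apply fsum_integer; intros i.
  destruct (Ha i) as [z Hz]; destruct (Hb i) as [z' Hz'].
  exists (z * z')%Z; rewrite Hz, Hz', mult_IZR; reflexivity.
Qed.

Lemma integer_iter n M a k : integer_matrix n M -> integer_vec n a ->
  integer_vec n (Nat.iter k (mvec n M) a).
Proof.
  intros HM Ha; induction k as [|k IH]; [exact Ha |]; intros i.
  rewrite Nat.iter_succ; apply (dot_integer n (M i)); [exact (HM i) | exact IH].
Qed.

Lemma mvec_idm n y : mvec n (idm n) y = y.
Proof.
  extensionality i; unfold mvec, idm; induction i as [n|n i IH]; simpl fsum.
  - destruct (Fin.eq_dec (@Fin.F1 n) Fin.F1) as [_|H]; [| congruence].
    transitivity (1 * y Fin.F1 + fsum n (fun i => 0 * y (Fin.FS i)));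
      [| rewrite fsum_scal; ring].
    f_equal.
  - destruct (Fin.eq_dec (Fin.FS i) Fin.F1) as [H|_]; [discriminate H |].
    rewrite Rmult_0_l, Rplus_0_l; etransitivity; [| apply (IH (fun i => y (Fin.FS i)))].
    apply fsum_ext; intros j.
    destruct (Fin.eq_dec (Fin.FS i) (Fin.FS j)) as [H|H], (Fin.eq_dec i j) as [H'|H']; auto.
    + apply Fin.FS_inj in H; contradiction.
    + subst; contradiction.
Qed.

Lemma mvec_mmul n M N y : mvec n M (mvec n N y) = mvec n (mmul n M N) y.
Proof.
  extensionality i; unfold mvec, mmul.
  transitivity (fsum n (fun j => fsum n (fun k => M i j * N j k * y k))).
  - apply fsum_ext; intros j; rewrite <- fsum_scal; apply fsum_ext; intros; ring.
  - rewrite fsum_swap; apply fsum_ext; intros k.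
    rewrite (Rmult_comm _ (y k)), <- fsum_scal; apply fsum_ext; intros; ring.
Qed.

(** If the transpose of [M] kills [v], then [v.v = v.(M N v) = (M^T v).(N v) = 0], where [N] is the
    inverse of [M]. *)
Lemma transpose_iter_nonzero n M a k : invertible n M -> (exists i, a i <> 0) ->
  exists i, Nat.iter k (mvec n (fun i j => M j i)) a i <> 0.
Proof.
  intros [N [HN _]] Ha; induction k as [|k IH]; [exact Ha |].
  rewrite Nat.iter_succ; set (v := Nat.iter k (mvec n (fun i j => M j i)) a) in *.
  apply NNPP; intros Hz; apply norm_gt0 in IH.
  assert (E : dot n v (mvec n M (mvec n N v)) = 0).
  { rewrite dot_mvec; unfold dot; rewrite (fsum_ext n _ (fun i => 0 * v i)).
    - rewrite fsum_scal; ring.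
    - intros i; replace (mvec n (fun i j => M j i) v i) with 0; [ring |].
      apply NNPP; intros H; apply Hz; exists i; auto. }
  rewrite mvec_mmul, HN, mvec_idm, dot_self, <- norm_sq in E; nra.
Qed.

(** For integral [a] the form [a.x] modulo [1] descends to the torus. The preimage [U] of the
    [delta]-interval around [a.y] is then an open neighbourhood of [y] that the orbit misses. *)
Lemma Etilde_intro n M (y : Tn n) a z : integer_vec n a ->
  (exists delta, 0 < delta /\ forall k (m : Z), delta <=
     Rabs (dot n (Nat.iter k (mvec n (fun i j => M j i)) a) z - dot n a (proj1_sig y) - IZR m)) ->
  Etilde n M y z.
Proof.
  intros Ha [delta [Hd Hgap]] Hcl.
  set (Y := dot n a (proj1_sig y)) in *.
  pose (U := fun t : Tn n => exists m : Z, Rabs (dot n a (proj1_sig t) - Y - IZR m) < delta).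
  assert (HU : forall x, U (pi n x) <-> exists m : Z, Rabs (dot n a x - Y - IZR m) < delta).
  { intros x; unfold U; simpl.
    destruct (dot_integer n a (fun i => IZR (Int_part (x i))) Ha) as [l Hl]; [intros i; eexists; reflexivity |].
    assert (E : dot n a (fun i => frac_part (x i)) = dot n a x - IZR l).
    { unfold frac_part; rewrite dot_minus, Hl; reflexivity. }
    rewrite E; split; intros [m Hm].
    - exists (m + l)%Z; rewrite plus_IZR.
      replace (dot n a x - Y - (IZR m + IZR l)) with (dot n a x - IZR l - Y - IZR m) by ring; auto.
    - exists (m - l)%Z; rewrite minus_IZR.
      replace (dot n a x - IZR l - Y - (IZR m - IZR l)) with (dot n a x - Y - IZR m) by ring; auto. }
  destruct (Hcl U) as [s [[k ->] Hs]].
  - intros x Hx; destruct (proj1 (HU x) Hx) as [m Hm].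
    pose proof (norm_ge0 n a).
    (* The form has Lipschitz constant [norm n a]; the [+ 1] only avoids dividing by zero. *)
    exists ((delta - Rabs (dot n a x - Y - IZR m)) / (norm n a + 1)).
    split; [apply Rdiv_lt_0_compat; lra |].
    intros w Hw; apply (proj2 (HU w)); exists m.
    pose proof (dot_lipschitz n a w x) as HL; rewrite dist_sym in HL.
    apply Rmult_lt_compat_l with (r := norm n a + 1) in Hw; [| lra].
    replace ((norm n a + 1) * ((delta - Rabs (dot n a x - Y - IZR m)) / (norm n a + 1)))
      with (delta - Rabs (dot n a x - Y - IZR m)) in Hw by (field; lra).
    pose proof (dist_ge0 n x w).
    pose proof (Rabs_triang (dot n a w - dot n a x) (dot n a x - Y - IZR m)) as Ht.
    replace (dot n a w - dot n a x + (dot n a x - Y - IZR m))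
      with (dot n a w - Y - IZR m) in Ht by ring.
    lra.
  - exists 0%Z; fold Y; rewrite Rminus_diag, Rminus_0_r, Rabs_R0; exact Hd.
  - destruct (proj1 (HU _) Hs) as [m Hm].
    rewrite dot_iter_mvec in Hm; specialize (Hgap k m); lra.
Qed.

(** * Arranging an integer orbit into levels *)

Lemma integer_interval_list B : exists l : list R, forall z : Z, Rabs (IZR z) <= B -> In (IZR z) l.
Proof.
  set (N := Z.to_nat (up B)).
  exists (map (fun k => IZR (Z.of_nat k - Z.of_nat N)) (seq 0 (2 * N + 1))).
  intros z Hz; apply Rabs_le_bounds in Hz; destruct (archimed B) as [HB _].
  assert (H1 : IZR z < IZR (up B)) by lra; assert (H2 : IZR (- z) < IZR (up B))
    by (rewrite opp_IZR; lra).
  apply lt_IZR in H1; apply lt_IZR in H2.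
  apply in_map_iff; exists (Z.to_nat (z + Z.of_nat N)); split; [f_equal; lia |].
  apply in_seq; lia.
Qed.

Lemma integer_box_list n B : exists l : list (Rn n),
  forall v, integer_vec n v -> (forall i, Rabs (v i) <= B) -> In v l.
Proof.
  induction n as [|n [l Hl]].
  - exists ((fun _ => 0) :: nil); intros v _ _; left.
    extensionality i; apply (Fin.case0 (fun i => 0 = v i)).
  - destruct (integer_interval_list B) as [zs Hzs].
    exists (map (fun p => fun i => Fin.caseS' i (fun _ => R) (fst p) (snd p)) (list_prod zs l)).
    intros v Hv HB; apply in_map_iff.
    exists (v Fin.F1, fun i => v (Fin.FS i)); split.
    + extensionality i; apply (Fin.caseS' i); [| intros i']; reflexivity.
    + apply in_prod.
      * destruct (Hv Fin.F1) as [z Hz]; specialize (HB Fin.F1); rewrite Hz in *; auto.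
      * apply Hl; [intros i; apply Hv | intros i; apply HB].
Qed.

Lemma finite_positive_bounds (f : nat -> R) N : exists c C, 0 < c /\ 0 < C /\
  forall j, (j < N)%nat -> 0 < f j -> c <= f j <= C.
Proof.
  induction N as [|N [c [C [Hc [HC H]]]]]; [exists 1, 1; repeat split; try lra; lia |].
  destruct (Rlt_dec 0 (f N)) as [Hf|Hf].
  - exists (Rmin c (f N)), (Rmax C (f N)).
    pose proof (Rmin_l c (f N)); pose proof (Rmin_r c (f N)).
    pose proof (Rmax_l C (f N)); pose proof (Rmax_r C (f N)).
    split; [apply Rmin_glb_lt; lra |]; split; [lra |]; intros j Hj Hfj.
    destruct (Nat.eq_dec j N) as [->|Hne]; [lra |].
    specialize (H j ltac:(lia) Hfj); lra.
  - exists c, C; split; [exact Hc |]; split; [exact HC |]; intros j Hj Hfj.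
    destruct (Nat.eq_dec j N) as [->|Hne]; [lra | apply H; [lia | exact Hfj]].
Qed.

(* An orbit that is not lacunary is bounded, hence consists of finitely many integer vectors,
   for which two-sided geometric bounds hold trivially. *)
Lemma orbit_levels n M a q c d : integer_matrix n M -> invertible n M ->
  integer_vec n a -> (exists i, a i <> 0) -> (1 <= n)%nat -> 0 <= q -> 0 < c -> 0 < d ->
  (forall k, c * q ^ k <= fsum n (fun i => Rabs (Nat.iter k (mvec n (fun i j => M j i)) a i))
             <= d * q ^ k) ->
  exists (u : nat -> Rn n) (D : nat -> Prop) (q' c1 C1 : R),
    1 < q' /\ 0 < c1 /\ 0 < C1 /\
    (forall j, D j -> c1 * q' ^ j <= norm n (u j) <= C1 * q' ^ j) /\
    forall k, exists j, D j /\ u j = Nat.iter k (mvec n (fun i j => M j i)) a.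
Proof.
  intros HM Hinv Ha Hnz Hn Hq Hc Hd Hgrow.
  set (v := fun k => Nat.iter k (mvec n (fun i j => M j i)) a).
  destruct (Rle_lt_dec q 1) as [Hq1|Hq1].
  - destruct (integer_box_list n d) as [l Hl].
    set (u := fun j => nth j l (fun _ => 0)).
    destruct (finite_positive_bounds (fun j => norm n (u j) / 2 ^ j) (length l))
      as [c1 [C1 [Hc1 [HC1 Hb]]]].
    (* Here [j] is a position in the list, unrelated to time, and the base [2] is an arbitrary
       number above [1]. The zero vector of the box is excluded through [D]; the orbit never meets
       it because [M] is invertible. *)
    exists u, (fun j => (j < length l)%nat /\ exists i, u j i <> 0), 2, c1, C1.
    split; [lra |]; split; [exact Hc1 |]; split; [exact HC1 |]; split.
    + intros j [Hj Hi]; apply norm_gt0 in Hi.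
      assert (H2 : 0 < 2 ^ j) by (apply pow_lt; lra).
      specialize (Hb j Hj (Rdiv_lt_0_compat _ _ Hi H2)).
      replace (norm n (u j)) with (norm n (u j) / 2 ^ j * 2 ^ j) by (field; lra).
      split; apply Rmult_le_compat_r; lra.
    + intros k; assert (Hin : In (v k) l).
      { apply Hl.
        - apply integer_iter; [intros i j; apply HM | exact Ha].
        - intros i; destruct (Hgrow k) as [_ Hk].
          pose proof (fsum_term_le n (fun i => Rabs (v k i)) i (fun _ => Rabs_pos _)) as Ht.
          assert (q ^ k <= 1) by (rewrite <- (pow1 k); apply pow_incr; lra).
          simpl in Ht; unfold v in *; nra. }
      apply (In_nth l _ (fun _ => 0)) in Hin; destruct Hin as [j [Hj E]].
      exists j; split; [split; [exact Hj |] | exact E].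
      unfold u; rewrite E; apply transpose_iter_nonzero; assumption.
  - assert (HnR : 0 < INR n) by (apply lt_0_INR; lia).
    (* The factor [/ INR n] comes from comparing the sum of absolute values with the Euclidean
       norm. *)
    exists v, (fun _ => True), q, (c / INR n), d.
    split; [exact Hq1 |]; split; [apply Rdiv_lt_0_compat; lra |]; split; [exact Hd |]; split.
    + intros k _; destruct (Hgrow k) as [H1 H2].
      pose proof (norm_le_sum n (v k)); pose proof (sum_le_norm n (v k)).
      unfold v in *; split; [| lra].
      apply Rmult_le_reg_l with (INR n); [exact HnR |].
      replace (INR n * (c / INR n * q ^ k)) with (c * q ^ k) by (field; lra); lra.
    + intros k; exists k; split; [exact I | reflexivity].
Qed.

Theorem theorem1p2 :
  forall (n : nat) (K : Rn n -> Prop),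
    (1 <= n)%nat ->
    (exists mu : (Rn n -> Prop) -> ereal,
        is_measure n mu /\ locally_finite n mu /\ absolutely_decaying n mu /\
        (forall x, K x <-> supp n mu x)) ->
    exists alpha : R, 0 < alpha < 1 /\
      forall (M : Mat n) (y : Tn n),
        integer_matrix n M -> invertible n M ->
        alpha_winning n K (Etilde n M y) alpha.
Proof.
  intros n K Hn [mu [Hmu [_ [Hdec HK]]]].
  (* [alpha] is fixed here, before [M], [y] and [beta] are introduced, and so depends on [K]
     alone. *)
  destruct (decaying_half_avoiding n K) as [alpha [rho0 [Halpha [Hrho0 Havoid]]]]; [eauto |].
  exists alpha; split; [exact Halpha |]; intros M y HM Hinv beta Hbeta.
  destruct n as [|n]; [lia |].
  destruct (@Orbit.integer_orbit_growth n M HM)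
    as [a [q [c [d [Ha [Hnz [Hq [Hc [Hd Hgrow]]]]]]]]].
  destruct (orbit_levels (S n) M a q c d HM Hinv Ha Hnz Hn Hq Hc Hd Hgrow)
    as [u [D [q' [c1 [C1 [Hq' [Hc1 [HC1 [Hu Horb]]]]]]]]].
  (* The hyperplanes to avoid have offset [c = a.y] and normals taken from the orbit of [a]. *)
  apply (game_winning (S n) K alpha rho0 Halpha Hrho0 Havoid u D (dot (S n) a (proj1_sig y))
    q' c1 C1 Hq' Hc1 HC1 Hu beta Hbeta).
  intros z [delta [Hdelta Hgap]]; apply (Etilde_intro (S n) M y a z Ha).
  exists delta; split; [exact Hdelta |]; intros k m.
  destruct (Horb k) as [j [Dj <-]]; apply Hgap, Dj.
Qed.
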